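(* Let $N\ge2$ be an integer and let $[\beta_L,\beta_U]$ be an admissible interval generated by an admissible block $t_1\cdots t_p$. Then for any $\beta\in[\beta_L,\beta_U]$ the Hausdorff dimension of $\mathbf{U}_{\beta,N}$ is given by $$\dim_H\mathbf{U}_{\beta,N}=\frac{h(Z_{t_1\cdots t_p})}{\log\beta},$$ where $h(Z_{t_1\cdots t_p})$ is the topological entropy of the subshift of finite type $$Z_{t_1\cdots t_p}:=\big\{(d_i)\in\{0,\dots,N-1\}^{\infty}:\ \overline{t_1\cdots t_p}\le d_n\cdots d_{n+p-1}\le t_1\cdots t_p\ \text{ for all } n\ge1\big\}.$$
   Context: Fix an integer $N\ge 2$. Blocks of equal length and infinite sequences over $\{0,1,\dots,N-1\}$ are compared lexicographically. For a digit $c$, $\overline{c}:=N-1-c$, and $\overline{c_1c_2\cdots}:=\overline{c_1}\,\overline{c_2}\cdots$ for blocks and sequences. For a block with $c_p<N-1$, $c_1\cdots c_p^+:=c_1\cdots c_{p-1}(c_p+1)$. $(c_1\cdots c_p)^\infty$ is the periodic sequence repeating the block. For $\beta>1$, a $\beta$-expansion of $x$ is a sequence $(d_i)\in\{0,\dots,N-1\}^\infty$ with $x=\sum_{i\ge1}d_i\beta^{-i}$. $\Gamma_{\beta,N}$ is the set of all $x$ having a $\beta$-expansion and $\mathbf{U}_{\beta,N}$ is the set of $x\in\Gamma_{\beta,N}$ having exactly one $\beta$-expansion. Quasi-greedy expansion: for $\beta\in(1,N]$, $(\alpha_i(\beta))_{i\ge1}$ is the quasi-greedy $\beta$-expansion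 of $1$: $\alpha_n(\beta)$ is recursively the largest element of $\{0,\dots,N-1\}$ with $\sum_{i=1}^{n}\alpha_i(\beta)\beta^{-i}<1$. Admissible block: $t_1\cdots t_p\in\{0,\dots,N-1\}^p$ is admissible if $t_p<N-1$ and for every $1\le i\le p$: $\overline{t_1\cdots t_p}\le t_i\cdots t_pt_1\cdots t_{i-1}$ and $t_i\cdots t_p^+\,\overline{t_1\cdots t_{i-1}}\le t_1\cdots t_p^+$. Generalized Thue-Morse sequence: $(\theta_i)=(\theta_i(t_1\cdots t_p^+))$ is defined by $\theta_1\cdots\theta_p=t_1\cdots t_p^+$ and, for $m\ge0$, $\theta_{2^mp+1}\cdots\theta_{2^{m+1}p}=\overline{\theta_1\cdots\theta_{2^mp}}\,^+$. Admissible interval: $[\beta_L,\beta_U]$ is the admissible interval generated by an admissible block $t_1\cdots t_p$ if $\beta_L,\beta_U\in(1,N]$ satisfy $(\alpha_i(\beta_L))=(t_1\cdots t_p)^\infty$ and $(\alpha_i(\beta_U))=(\theta_i(t_1\cdots t_p^+))$. Topological entropy of a subshift $X$: $h(X)=\lim_{n\to\infty}\frac1n\log\#B_n(X)$, with $B_n(X)$ the set of blocks of length $n$ occurring in elements of $X$ (natural logarithm). *)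

(* Defs.v *)
From mathcomp Require Import all_boot all_order all_algebra.
From mathcomp Require Import all_classical all_reals all_analysis.

Set Implicit Arguments.
Unset Strict Implicit.
Unset Printing Implicit Defensive.

Import Order.TTheory GRing.Theory Num.Theory.
Import numFieldNormedType.Exports.

Local Open Scope classical_set_scope.
Local Open Scope ring_scope.

(* Blocks are [seq nat] and infinite sequences are [nat -> nat], with the
   bound on the digits kept as a separate condition.  Indices start at 0: the
   digit written d_(i+1) in the usual notation is [d i], and has weight
   beta^-(i+1). *)

Section Words.
Local Open Scope nat_scope.

Definition is_block (N : nat) (s : seq nat) : bool := all (fun c => c < N) s.

Definition digit_sequence (N : nat) (d : nat -> nat) : Prop :=
  forall i, d i < N.

Definition block_le (s t : seq nat) : bool := ((s : seqlexi nat) <= t)%O.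

Definition reflection (N : nat) (s : seq nat) : seq nat :=
  [seq N.-1 - c | c <- s].

Definition incr_last (s : seq nat) : seq nat := incr_nth s (size s).-1.

Definition periodic (s : seq nat) (i : nat) : nat := nth 0 s (i %% size s).

Definition subword (d : nat -> nat) (n p : nat) : seq nat :=
  mkseq (fun i => d (n + i)) p.

Definition admissible (N : nat) (t : seq nat) : Prop :=
  [/\ 0 < size t, is_block N t, last 0 t < N.-1 &
      forall i, i < size t ->
        block_le (reflection N t) (drop i t ++ take i t) /\
        block_le (drop i (incr_last t) ++ reflection N (take i t)) (incr_last t)].

(* The block theta_1 ... theta_(2^m p), where p is the length of t. *)
Fixpoint thue_morse_block (N : nat) (t : seq nat) (m : nat) : seq nat :=
  if m is m'.+1 then
    let s := thue_morse_block N t m' in s ++ incr_last (reflection N s)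
  else incr_last t.

(* These blocks extend each other and, for t nonempty, the i-th one has
   length 2^i p > i. *)
Definition thue_morse (N : nat) (t : seq nat) (i : nat) : nat :=
  nth 0 (thue_morse_block N t i) i.

Definition Zshift (N : nat) (t : seq nat) : set (nat -> nat) :=
  [set d | digit_sequence N d /\
     forall n, block_le (reflection N t) (subword d n (size t)) /\
               block_le (subword d n (size t)) t].

Definition language (N : nat) (X : set (nat -> nat)) (n : nat) :
    {set n.-tuple 'I_N} :=
  [set w : n.-tuple 'I_N |
     `[< exists2 d, X d & exists k, map val w = subword d k n >]]%SET.

End Words.

Definition entropy (R : realType) (N : nat) (X : set (nat -> nat)) : R :=
  limn (fun n => ln (#|language N X n|%:R) / n%:R).

Section Expansions.
Variables (R : realType) (N : nat) (beta : R).

Definition expansion (x : R) (d : nat -> nat) : Prop :=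
  digit_sequence N d /\
  series (fun i => (d i)%:R / beta ^+ i.+1) @ \oo --> x.

Definition Gamma : set R := [set x | exists d, expansion x d].

Definition univoque : set R := [set x | Gamma x /\ exists! d, expansion x d].

Definition block_value (s : seq nat) : R :=
  \sum_(i < size s) (nth 0%N s i)%:R / beta ^+ i.+1.

Fixpoint quasi_greedy_prefix (n : nat) : seq nat :=
  if n is n'.+1 then
    let s := quasi_greedy_prefix n' in
    rcons s (\max_(c < N | (block_value (rcons s c) < 1)%R) c)%N
  else [::].

Definition quasi_greedy (n : nat) : nat :=
  nth 0%N (quasi_greedy_prefix n.+1) n.

End Expansions.

Definition admissible_interval (R : realType) (N : nat) (t : seq nat)
    (betaL betaU : R) : Prop :=
  [/\ admissible N t, 1 < betaL <= N%:R, 1 < betaU <= N%:R,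
      quasi_greedy N betaL = periodic t &
      quasi_greedy N betaU = thue_morse N t].

Section Hausdorff.
Variable R : realType.
Local Open Scope ereal_scope.

(* The value on the empty set is -oo; [diam_pow] treats it separately. *)
Definition diam (A : set R) : \bar R :=
  ereal_sup [set (`|u.1 - u.2|%R)%:E | u in A `*` A].

(* The empty set contributes 0 to the sums, for every exponent s. *)
Definition diam_pow (s : R) (A : set R) : \bar R :=
  if A == set0 then 0 else diam A `^ s.

Definition delta_cover (delta : R) (E : set R) (F : (set R)^nat) : Prop :=
  E `<=` \bigcup_k F k /\ forall k, diam (F k) <= delta%:E.

Definition hausdorff_content (s delta : R) (E : set R) : \bar R :=
  ereal_inf [set \sum_(k <oo) diam_pow s (F k) | F in delta_cover delta E].

Definition hausdorff_measure (s : R) (E : set R) : \bar R :=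
  ereal_sup [set hausdorff_content s delta E | delta in [set e | (0 < e)%R]].

Definition hausdorff_dim (E : set R) : \bar R :=
  ereal_inf [set s%:E | s in [set s | (0 <= s)%R /\ hausdorff_measure s E = 0]].

End Hausdorff.

(* Main.v *)
Require Import Defs.
From mathcomp Require Import all_boot all_order all_algebra.
From mathcomp Require Import all_classical all_reals all_analysis.
From mathcomp Require Import zify ring lra.

(** Write pi(d) for the sum of the series d_1/beta + d_2/beta^2 + ..., Z for the
    subshift of finite type of the statement, h for its entropy and theta for
    the generalized Thue-Morse sequence. The number h / log beta is the box
    dimension of pi(Z). Two points make the theorem true: for every beta of the
    interval, countably many points and pieces of arbitrarily small dimension
    account for the difference between pi(Z), up to finite words put in front,
    and the univoque set; and for the values of a shift-invariant closed set
    the Hausdorff dimension is the box dimension.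

    Lower bound. A sequence d of Z stays below t at each window, and t repeated
    forever is worth at most 1 in the base beta >= betaL; so all tails of d have
    values at most 1 (Zshift_value_le1), and by reflection all of them have
    values at least (N-1)/(beta-1) - 1. Equality occurs only for t t t ... and
    its reflection, hence d is a unique expansion unless it ends in one of these
    (Zshift_univoque), which excludes countably many d. The same bounds show
    that values of sequences of Z that first differ at the digit n are at
    distance c beta^-n or more (Zshift_separation), where c > 0 since beta < N.
    So, if the univoque set has measure 0 for the exponent s, then Z is covered
    by cylinders whose lengths m_k satisfy sum_k beta^(-m_k s) <= 1, and by
    compactness by finitely many of them. As Z is invariant under the shift,
    its words are concatenations of the corresponding blocks up to a bounded
    remainder, so that their number grows at most like beta^(n s)
    (card_language_le), whence h <= s log beta.

    Upper bound. A unique expansion that is not constant has a tail e all of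
    whose tails, reflected or not, are worth less than 1 (univoque_tail). In the
    base betaU >= beta they are still worth less than 1, so all their prefixes
    are at most those of the quasi-greedy expansion theta
    (block_le_quasi_greedy). If e is not in Z, then one of its windows is t^+ or
    the reflection of t^+. From there on the self-similarity of theta acts: a
    sequence bounded by theta that begins with s = theta_1 ... theta_L,
    L = 2^m p, either alternates forever between s and its reflection, or has a
    tail that begins with theta_1 ... theta_2L or the reflection of this block
    (level_decomposition). So, apart from countably many sequences, tails of
    every level m are reached; at the level m at most four blocks of length L
    occur at the multiples of L (level_subword), and the dimension is at most
    log 4 / (L log beta), which is as small as desired. As null sets are stable
    under countable unions (null_bigcup), all exponents s > h / log beta are
    null for the univoque set. *)

Set Implicit Arguments.
Unset Strict Implicit.
Unset Printing Implicit Defensive.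

Import Order.TTheory GRing.Theory Num.Theory.
Import numFieldNormedType.Exports.

(** * Words in lexicographic order *)

Section Words.
Local Open Scope nat_scope.

Definition tail (n : nat) (d : nat -> nat) : nat -> nat := fun i => d (n + i).

Definition mirror (N : nat) (d : nat -> nat) : nat -> nat :=
  fun i => N.-1 - d i.

Lemma block_le_cons x s y t :
  block_le (x :: s) (y :: t) = (x < y) || (x == y) && block_le s t.
Proof. by rewrite /block_le Order.SeqLexiOrder.lexi_cons !leEnat; case: ltngtP. Qed.

Lemma block_le_refl s : block_le s s.
Proof. exact: lexx. Qed.

Lemma block_le_total s t : block_le s t || block_le t s.
Proof. exact: le_total. Qed.

Lemma block_le_catl a b a' b' : size a = size a' ->
  block_le (a ++ b) (a' ++ b') -> block_le a a'.
Proof.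
elim: a a' => [|x a IH] [|y a'] //= [sz]; rewrite !block_le_cons.
by case: ltngtP => //= _; apply: IH.
Qed.

Lemma block_le_cat2 a b b' : block_le (a ++ b) (a ++ b') = block_le b b'.
Proof. by elim: a => //= x a IH; rewrite block_le_cons ltnn eqxx. Qed.

Lemma block_le_cat a b a' b' : size a = size a' -> block_le a a' ->
  (a = a' -> block_le b b') -> block_le (a ++ b) (a' ++ b').
Proof.
elim: a a' => [|x a IH] [|y a'] //= => [_ _ ->//|[sz]]; rewrite !block_le_cons.
by case: ltngtP => //= <- le_aa' H; apply: IH => // eqa; apply: H; rewrite eqa.
Qed.

Lemma block_le_reflection N s t : size s = size t -> is_block N s -> is_block N t ->
  block_le (reflection N s) (reflection N t) = block_le t s.
Proof.
elim: s t => [|x s IH] [|y t] //= [sz] /andP[xN sN] /andP[yN tN].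
rewrite !block_le_cons IH //.
have -> : (N.-1 - x < N.-1 - y) = (y < x) by apply/idP/idP; lia.
by have -> : (N.-1 - x == N.-1 - y) = (y == x) by apply/idP/idP; lia.
Qed.

Lemma reflectionK N s : is_block N s -> reflection N (reflection N s) = s.
Proof.
by elim: s => //= x s IH /andP[xN sN]; rewrite IH //; congr cons; lia.
Qed.

Lemma size_reflection N s : size (reflection N s) = size s.
Proof. by rewrite size_map. Qed.

Lemma is_block_reflection N s : 0 < N -> is_block N (reflection N s).
Proof. by move=> N0; apply/allP => _ /mapP[c _ ->]; lia. Qed.

Lemma block_le_diff u v : size u = size v -> block_le u v ->
  u = v \/ exists k, [/\ k < size u, take k u = take k v &
                         nth 0 u k < nth 0 v k].
Proof.
elim: u v => [|x u IH] [|y v] //= => [_ _|[sz]]; first by left.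
rewrite block_le_cons => /orP[xy|/andP[/eqP <- /(IH _ sz)]].
  by right; exists 0; rewrite !take0.
case=> [->|[k [ku tk nk]]]; first by left.
by right; exists k.+1; rewrite /= tk.
Qed.

Lemma size_incr_last s : 0 < size s -> size (incr_last s) = size s.
Proof. by move=> s0; rewrite size_incr_nth; case: ifP => //; lia. Qed.

Lemma incr_last_rcons s x : incr_last (rcons s x) = rcons s x.+1.
Proof.
rewrite /incr_last size_rcons /=.
by elim: s => //= y s ->.
Qed.

Lemma incr_last_cat s t : 0 < size t -> incr_last (s ++ t) = s ++ incr_last t.
Proof.
case/lastP: t => [//|t x] _.
by rewrite -rcons_cat !incr_last_rcons rcons_cat.
Qed.

(** Only the last digit can differ when u <= w <= u^+, because u and u^+ share
    all the others. *)
Lemma block_le_incr_last u w : size u = size w -> 0 < size u ->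
  block_le u w -> block_le w (incr_last u) -> w = u \/ w = incr_last u.
Proof.
case/lastP: u => [//|u x]; case/lastP: w => [|w y]; first by rewrite size_rcons.
rewrite !size_rcons incr_last_rcons -!cats1 => -[sz] _ uw wu.
have eqw : u = w.
  apply/eqP; rewrite -[_ == _]/((u : seqlexi nat) == w) eq_le.
  by apply/andP; split; [apply: block_le_catl uw | apply: block_le_catl wu].
move: uw wu; rewrite eqw !block_le_cat2 !block_le_cons /= !andbT => H1 H2.
have [->|->] : y = x \/ y = x.+1 by lia.
  by left.
by right.
Qed.

Lemma size_subword d n p : size (subword d n p) = p.
Proof. exact: size_mkseq. Qed.

Lemma nth_subword d n p i : i < p -> nth 0 (subword d n p) i = d (n + i).
Proof. exact: nth_mkseq. Qed.

Lemma eq_subword d n d' n' p :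
  (forall i, i < p -> d (n + i) = d' (n' + i)) -> subword d n p = subword d' n' p.
Proof.
move=> H; apply: (@eq_from_nth _ 0); rewrite !size_subword// => i ip.
by rewrite !nth_subword// H.
Qed.

Lemma subwordP d n p d' n' i : subword d n p = subword d' n' p -> i < p ->
  d (n + i) = d' (n' + i).
Proof. by move=> H ip; rewrite -(nth_subword d n ip) H nth_subword. Qed.

Lemma subwordD d n p q :
  subword d n (p + q) = subword d n p ++ subword d (n + p) q.
Proof.
apply: (@eq_from_nth _ 0); rewrite ?size_cat !size_subword// => i ipq.
rewrite nth_subword// nth_cat size_subword; case: ltnP => ip.
  by rewrite nth_subword.
by rewrite nth_subword; [congr d | ]; lia.
Qed.

Lemma subwordS d n p : subword d n p.+1 = rcons (subword d n p) (d (n + p)).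
Proof. by rewrite -addn1 subwordD cats1 /subword /mkseq /= addn0. Qed.

Lemma subword_tail m d n p : subword (tail m d) n p = subword d (m + n) p.
Proof. by apply: eq_subword => i _; rewrite /tail addnA. Qed.

Lemma tail_tail m n d : tail m (tail n d) = tail (n + m) d.
Proof. by apply/funext => i; rewrite /tail addnA. Qed.

Lemma tail0 d : tail 0 d = d.
Proof. by []. Qed.

Lemma mirror_tail N n d : mirror N (tail n d) = tail n (mirror N d).
Proof. by []. Qed.

Lemma reflection_subword N d n p :
  reflection N (subword d n p) = subword (mirror N d) n p.
Proof. by rewrite /reflection /subword /mkseq -map_comp. Qed.

Lemma is_block_subword N d n p : digit_sequence N d -> is_block N (subword d n p).
Proof. by move=> dN; apply/allP => _ /mapP[i _ ->]; apply: dN. Qed.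

Lemma digits_tail N n d : digit_sequence N d -> digit_sequence N (tail n d).
Proof. by move=> dN i; apply: dN. Qed.

Lemma digits_mirror N d : 0 < N -> digit_sequence N (mirror N d).
Proof. by move=> N0 i; rewrite /mirror; lia. Qed.

Lemma mirrorK N d : digit_sequence N d -> mirror N (mirror N d) = d.
Proof. by move=> dN; apply/funext => i; have := dN i; rewrite /mirror; lia. Qed.

Lemma last_incr_last s : 0 < size s -> last 0 (incr_last s) = (last 0 s).+1.
Proof. by case/lastP: s => // s x _; rewrite incr_last_rcons !last_rcons. Qed.

Lemma last_reflection N s : 0 < size s ->
  last 0 (reflection N s) = N.-1 - last 0 s.
Proof. by case/lastP: s => // s x _; rewrite /reflection map_rcons !last_rcons. Qed.

Lemma is_block_incr_last N s : 0 < size s -> is_block N s -> last 0 s < N.-1 ->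
  is_block N (incr_last s).
Proof.
case/lastP: s => // s x _; rewrite incr_last_rcons last_rcons.
by rewrite /is_block !all_rcons => /andP[_ ->] ?; rewrite andbT; lia.
Qed.

End Words.

(** * The Thue-Morse blocks *)

Section ThueMorse.
Local Open Scope nat_scope.
Variables (N : nat) (t : seq nat).
Hypotheses (N1 : 1 < N) (t0 : 0 < size t) (tN : is_block N t)
  (tl : last 0 t < N.-1).

Local Notation tm := (thue_morse_block N t).

Lemma size_thue_morse_block m : size (tm m) = 2 ^ m * size t.
Proof.
elim: m => [|m IH] /=; first by rewrite size_incr_last// mul1n.
rewrite size_cat size_incr_last size_reflection IH ?muln_gt0 ?expn_gt0//.
by rewrite addnn -mul2n mulnA -expnS.
Qed.

Lemma thue_morse_block_gt0 m : 0 < size (tm m).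
Proof. by rewrite size_thue_morse_block muln_gt0 expn_gt0. Qed.

(** The last digit of theta_1 ... theta_L never vanishes, so the last digit of
    its reflection can be raised without leaving the alphabet. *)
Lemma thue_morse_blockP m : is_block N (tm m) /\ 0 < last 0 (tm m).
Proof.
elim: m => [|m [IH1 IH2]] /=.
  by rewrite last_incr_last//; split => //; apply: is_block_incr_last.
have r0 : 0 < size (reflection N (tm m)).
  by rewrite size_reflection thue_morse_block_gt0.
rewrite /is_block all_cat last_cat; split.
  apply/andP; split=> //; apply: is_block_incr_last => //.
    by apply: is_block_reflection; lia.
  by rewrite last_reflection ?thue_morse_block_gt0//; lia.
have := last_incr_last r0.
by case: (incr_last (reflection N (tm m))) => [//|x s] /= ->.
Qed.

Lemma last_reflection_thue_morse_block m :
  last 0 (reflection N (tm m)) < N.-1.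
Proof.
rewrite last_reflection ?thue_morse_block_gt0//.
by have [_] := thue_morse_blockP m; lia.
Qed.

Lemma nth_thue_morse_block m k i : m <= k -> i < size (tm m) ->
  nth 0 (tm k) i = nth 0 (tm m) i.
Proof.
move=> /subnKC <-; elim: (k - m) => [|j IH] im; first by rewrite addn0.
rewrite addnS /= nth_cat ifT ?IH//.
apply: leq_trans im _; rewrite !size_thue_morse_block leq_mul2r leq_exp2l//.
by rewrite leq_addr orbT.
Qed.

Lemma subword_thue_morse m :
  subword (thue_morse N t) 0 (size (tm m)) = tm m.
Proof.
apply: (@eq_from_nth _ 0); rewrite ?size_subword// => i im.
rewrite nth_subword// add0n /thue_morse.
have [mi|im'] := leqP m i; first exact: nth_thue_morse_block.
apply/esym/nth_thue_morse_block; first exact: ltnW.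
rewrite size_thue_morse_block; apply: leq_trans (ltn_expl i (isT : 1 < 2)) _.
by rewrite leq_pmulr.
Qed.

Lemma digits_thue_morse : digit_sequence N (thue_morse N t).
Proof.
move=> i; apply: (allP (thue_morse_blockP i).1); apply: mem_nth.
by rewrite size_thue_morse_block; have := ltn_expl i (isT : 1 < 2); nia.
Qed.

(** If all digits were N-1, the second half of the block of index 2, which is
    a reflection except at its last digit, would begin with 0. *)
Lemma thue_morse_not_max : exists i, thue_morse N t i != N.-1.
Proof.
apply: contrapT => /forallNP H.
have {}H i : thue_morse N t i = N.-1 by apply/eqP/negPn/negP/H.
(* The index 1 rather than 0 makes the block longer than one digit, so that
   its first digit is not the raised one. *)
set L := size (tm 1).
have L2 : 1 < L by rewrite /L size_thue_morse_block; lia.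
have tmE m i : i < size (tm m) -> nth 0 (tm m) i = N.-1.
  by move=> im; rewrite -subword_thue_morse nth_subword// H.
have := @tmE 2 L; rewrite size_thue_morse_block -[2 ^ 2]/(2 * 2 ^ 1) -mulnA.
rewrite -size_thue_morse_block -/L => /(_ ltac:(lia)).
rewrite -[tm 2]/(tm 1 ++ incr_last (reflection N (tm 1))) nth_cat ltnn subnn.
have szr : size (reflection N (tm 1)) = L by rewrite size_reflection.
rewrite /incr_last nth_incr_nth szr.
rewrite (nth_map 0)// ?(tmE 1 0)//; [lia | exact: ltnW | exact: ltnW].
Qed.

End ThueMorse.

(** * Sequences bounded by the Thue-Morse sequence *)

Section Renormalization.
Local Open Scope nat_scope.
Variables (N : nat) (t : seq nat).
Hypotheses (N1 : 1 < N) (t0 : 0 < size t) (tN : is_block N t)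
  (tl : last 0 t < N.-1).

Local Notation tm := (thue_morse_block N t).
Local Notation theta := (thue_morse N t).

Definition lex_bounded (e : nat -> nat) : Prop := digit_sequence N e /\
  forall n m, block_le (subword e n m) (subword theta 0 m) /\
              block_le (subword (mirror N e) n m) (subword theta 0 m).

Lemma lex_bounded_tail k e : lex_bounded e -> lex_bounded (tail k e).
Proof.
case=> eN H; split; first exact: digits_tail.
by move=> n m; rewrite mirror_tail !subword_tail.
Qed.

Lemma lex_bounded_mirror e : lex_bounded e -> lex_bounded (mirror N e).
Proof.
case=> eN H; split; first by apply: digits_mirror; lia.
by move=> n m; rewrite mirrorK//; case: (H n m).
Qed.

(** The stages of the renormalization: the higher the level m, the fewer words
    of a given length these sequences show. *)
Definition level (m : nat) (e : nat -> nat) : Prop := lex_bounded e /\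
  (subword e 0 (size (tm m)) = tm m \/
   subword (mirror N e) 0 (size (tm m)) = tm m).

Lemma level_mirror m e : level m e -> level m (mirror N e).
Proof.
move=> [eb H]; split; first exact: lex_bounded_mirror.
by rewrite mirrorK; [case: H; [right|left] | case: eb].
Qed.

Lemma size_thue_morse_blockS m : size (tm m.+1) = size (tm m) + size (tm m).
Proof. by rewrite !size_thue_morse_block// expnS; lia. Qed.

(** A block s = theta_1 ... theta_L, L = 2^m p, in a sequence bounded by theta
    is followed by a block between the reflection of s and its successor: the
    first inequality is the lower bound at the next position, the second one
    the upper bound over the length 2L. *)
Lemma thue_morse_block_next m e : lex_bounded e ->
  subword e 0 (size (tm m)) = tm m ->
  subword (mirror N e) (size (tm m)) (size (tm m)) = tm m \/
  subword e 0 (size (tm m.+1)) = tm m.+1.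
Proof.
move=> [eN H] es; set L := size (tm m).
have L0 : 0 < L by exact: thue_morse_block_gt0.
have [tmN _] : is_block N (tm m) /\ 0 < last 0 (tm m) by exact: thue_morse_blockP.
set u := subword e L L.
have uN : is_block N u by exact: is_block_subword.
have su : size u = L by rewrite size_subword.
have le1 : block_le (reflection N (tm m)) u.
  rewrite -(reflectionK uN) block_le_reflection ?size_reflection//.
    rewrite reflection_subword.
    by have [_] := H L L; rewrite subword_thue_morse.
  by apply: is_block_reflection; lia.
have le2 : block_le u (incr_last (reflection N (tm m))).
  have [+ _] := H 0 (L + L).
  rewrite -size_thue_morse_blockS subword_thue_morse// size_thue_morse_blockS.
  by rewrite subwordD add0n es /= block_le_cat2.
have [||uE|uE] := block_le_incr_last _ _ le1 le2.
- by rewrite size_reflection su.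
- by rewrite size_reflection.
- left; rewrite -reflection_subword -/u uE reflectionK//.
- by right; rewrite size_thue_morse_blockS subwordD add0n es /= -/u uE.
Qed.

Lemma lex_bounded_above n e : lex_bounded e ->
  ~~ block_le (subword e n (size t)) t -> level 0 (tail n e).
Proof.
move=> eb nle; split; first exact: lex_bounded_tail.
left; have szE : size (tm 0) = size t by rewrite size_incr_last.
have le1 : block_le t (subword e n (size t)).
  by have := block_le_total t (subword e n (size t)); rewrite (negPf nle) orbF.
have le2 : block_le (subword e n (size t)) (incr_last t).
  have [_ /(_ n (size t)) [+ _]] := eb.
  by rewrite -{2}szE subword_thue_morse.
have [||tE|tE] := block_le_incr_last _ _ le1 le2 => //.
- by rewrite size_subword.
- by move: nle; rewrite tE block_le_refl.
- by rewrite subword_tail addn0 szE tE.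
Qed.

(** The window bounds of the shift of finite type are t and its reflection,
    those of theta are t^+ and its reflection: leaving the shift means showing
    one of the latter two blocks. *)
Lemma lex_bounded_Zshift e : lex_bounded e ->
  Zshift N t e \/ exists k, level 0 (tail k e).
Proof.
move=> eb; have [eN _] := eb.
have [[k ek]|/forallNP H] := pselect (exists k, level 0 (tail k e)).
  by right; exists k.
left; split => // n; split.
  apply/negPn/negP => nle; apply: (H n).
  rewrite -(mirrorK (digits_tail n eN)); apply: level_mirror.
  rewrite mirror_tail; apply: lex_bounded_above; first exact: lex_bounded_mirror.
  apply: contra nle; rewrite -reflection_subword => le1.
  rewrite -(reflectionK (is_block_subword n (size t) eN)) block_le_reflection//.
    by rewrite size_reflection size_subword.
  by apply: is_block_reflection; lia.
by apply/negPn/negP => nle; apply: (H n); apply: lex_bounded_above.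
Qed.

Definition alternation (u : seq nat) (i : nat) : nat :=
  let c := nth 0 u (i %% size u) in
  if odd (i %/ size u) then N.-1 - c else c.

Lemma alternation_tail u i : 0 < size u -> is_block N u ->
  alternation u (size u + i) = N.-1 - alternation u i.
Proof.
move=> u0 uN; rewrite /alternation modnDl divnDl ?dvdnn// divnn u0 oddD /=.
case: odd => //=.
have : nth 0 u (i %% size u) < N.
  by apply: (allP uN); apply: mem_nth; rewrite ltn_mod.
by lia.
Qed.

(** As long as the block of the next level does not appear, each block of
    length L is followed by its reflection. *)
Lemma level_decomposition m e : level m e ->
  [\/ exists k, level m.+1 (tail k e),
      e = alternation (tm m) | e = mirror N (alternation (tm m))].
Proof.
move=> lev.
have [ex|/forallNP H] := pselect (exists k, level m.+1 (tail k e)).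
  by constructor 1.
set L := size (tm m).
have L0 : 0 < L by exact: thue_morse_block_gt0.
have [tmN _] : is_block N (tm m) /\ 0 < last 0 (tm m) by exact: thue_morse_blockP.
have main j f : lex_bounded f -> subword f 0 L = tm m ->
    (forall k, ~ level m.+1 (tail k f)) ->
    forall i, i < j * L -> f i = alternation (tm m) i.
  elim: j f => // j IH f fb fs fl i iL.
  have [iL'|Li] := ltnP i L.
    rewrite /alternation modn_small// divn_small//= -/L -fs nth_subword//.
  have [fN _] := fb.
  have [sf|sf] := thue_morse_block_next fb fs; last first.
    by case: (fl 0); rewrite tail0; split => //; left.
  rewrite -(subnKC Li) alternation_tail// -/L -(IH (tail L (mirror N f))).
  - by rewrite /tail /mirror; have := fN (L + (i - L)); lia.
  - exact/lex_bounded_tail/lex_bounded_mirror.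
  - by rewrite subword_tail addn0.
  - move=> k; rewrite tail_tail -mirror_tail => lk; apply: (fl (L + k)).
    by rewrite -(mirrorK (digits_tail _ fN)); apply: level_mirror.
  - by rewrite mulSn in iL; lia.
have [eb [es|es]] := lev.
  constructor 2; apply/funext => i; apply: (main i.+1 e) => //; nia.
constructor 3; have [eN _] := eb.
rewrite -(mirrorK eN); congr mirror; apply/funext => i.
apply: (main i.+1) => //.
- exact: lex_bounded_mirror.
- move=> k; rewrite -mirror_tail => lk; apply: (H k).
  by rewrite -(mirrorK (digits_tail _ eN)); apply: level_mirror.
- by nia.
Qed.

(** The block s = theta_1 ... theta_L, its predecessor s^-, written as the
    reflection of the successor of the reflection of s, and the reflections of
    both. *)
Definition level_blocks (m : nat) : seq (seq nat) :=
  let s := tm m in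
  [:: s; reflection N (incr_last (reflection N s));
      reflection N s; incr_last (reflection N s)].

Fixpoint level_words (m k : nat) : seq (seq nat) :=
  if k is k'.+1 then [seq u ++ v | u <- level_blocks m, v <- level_words m k']
  else [:: [::]].

Lemma level_wordsS m k :
  level_words m k.+1 = [seq u ++ v | u <- level_blocks m, v <- level_words m k].
Proof. by []. Qed.

Lemma size_level_words m k : size (level_words m k) = 4 ^ k.
Proof.
elim: k => [//|k IH]; rewrite level_wordsS.
by rewrite size_allpairs IH expnS.
Qed.

Lemma is_block_incr_last_reflection m :
  is_block N (incr_last (reflection N (tm m))).
Proof.
apply: is_block_incr_last.
- by rewrite size_reflection thue_morse_block_gt0.
- by apply: is_block_reflection; lia.
- exact: last_reflection_thue_morse_block.
Qed.

Lemma reflection_level_words m k w :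
  w \in level_words m k -> reflection N w \in level_words m k.
Proof.
have [tmN _] : is_block N (tm m) /\ 0 < last 0 (tm m) by exact: thue_morse_blockP.
elim: k w => [|k IH] w; first by rewrite !inE => /eqP ->.
rewrite level_wordsS => /allpairsP[[u v] []]; rewrite [_.1]/= [_.2]/= => uS vk ->.
rewrite /reflection map_cat; apply: allpairs_f; last exact: IH.
move: uS; rewrite -/(reflection N u) !inE.
case/or4P => /eqP ->; rewrite ?reflectionK ?eqxx ?orbT//.
exact: is_block_incr_last_reflection.
Qed.

(** Cut at multiples of the length of s = theta_1 ... theta_L, a sequence of
    this level only shows s, its predecessor and their reflections: after s
    either the reflection of s occurs, or the first two blocks form the block
    of the next level, which is followed again by the reflection of s. *)
Lemma level_subword m k e : level m e ->
  subword e 0 (k * size (tm m)) \in level_words m k.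
Proof.
set L := size (tm m).
have [tmN _] : is_block N (tm m) /\ 0 < last 0 (tm m) by exact: thue_morse_blockP.
elim/ltn_ind: k e => k IH.
have {IH}main e : lex_bounded e -> subword e 0 L = tm m ->
    subword e 0 (k * L) \in level_words m k.
  move=> eb es; have [eN _] := eb.
  case: k IH => [//|k] IH.
  rewrite mulSn subwordD add0n es.
  rewrite level_wordsS; apply: allpairs_f.
    by rewrite inE eqxx.
  have [sf|sf] := thue_morse_block_next eb es.
    have := IH k (leqnn _) (tail L e).
    rewrite subword_tail addn0; apply; split; first exact: lex_bounded_tail.
    by right; rewrite mirror_tail subword_tail addn0.
  have sf' : subword e L L = incr_last (reflection N (tm m)).
    move: sf; rewrite size_thue_morse_blockS subwordD add0n es /= => /eqP.
    by rewrite eqseq_cat// eqxx => /eqP.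
  case: k IH => [//|k] IH.
  rewrite mulSn subwordD sf' level_wordsS.
  apply: allpairs_f; first by rewrite !inE eqxx !orbT.
  have := IH k (leqnSn _) (tail (L + L) e).
  rewrite subword_tail addn0; apply; split; first exact: lex_bounded_tail.
  right; rewrite mirror_tail subword_tail addn0 -/L.
  have [sg|sg] := thue_morse_block_next eb sf.
    move: sg; rewrite size_thue_morse_blockS -/L subwordD /= => /eqP.
    by rewrite eqseq_cat ?size_subword// => /andP[/eqP].
  have rw : tm m.+2 = tm m.+1 ++
      reflection N (tm m) ++ incr_last (reflection N (incr_last (reflection N (tm m)))).
    rewrite -incr_last_cat; first by rewrite /= /reflection map_cat.
    by rewrite size_reflection size_incr_last ?size_reflection thue_morse_block_gt0.
  move: sg; rewrite (size_thue_morse_blockS m.+1) rw subwordD add0n sf => /eqP.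
  rewrite eqseq_cat// eqxx andTb size_thue_morse_blockS subwordD.
  rewrite eqseq_cat ?size_subword ?size_map// => /andP[/eqP sg _].
  by rewrite -reflection_subword sg reflectionK.
move=> e [eb [es|es]]; first exact: main.
have [eN _] := eb.
rewrite -(reflectionK (is_block_subword 0 (k * L) eN)).
apply: reflection_level_words; rewrite reflection_subword.
by apply: main => //; exact: lex_bounded_mirror.
Qed.

End Renormalization.

(** * Values of sequences in a base *)

Section Value.
Local Open Scope ring_scope.
Local Open Scope classical_set_scope.
Variables (R : realType) (N : nat).
Hypothesis N1 : (1 < N)%N.

Definition weighted (beta : R) (d : nat -> nat) : nat -> R :=
  fun i => (d i)%:R / beta ^+ i.+1.

Definition value (beta : R) (d : nat -> nat) : R :=
  limn (series (weighted beta d)).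

(** The sum of the series whose digits are all N-1. *)
Definition max_value (beta : R) : R := N.-1%:R / (beta - 1).

Lemma block_value_subword beta d n :
  block_value beta (subword d 0 n) = series (weighted beta d) n.
Proof.
rewrite /block_value size_subword /series /= big_mkord.
by apply: eq_bigr => i _; rewrite nth_subword.
Qed.

Lemma seriesS beta d n : beta != 0 ->
  series (weighted beta d) n.+1 =
  ((d 0%N)%:R + series (weighted beta (tail 1 d)) n) / beta.
Proof.
move=> b0; rewrite /series /= big_nat_recl//= mulrDl; congr (_ + _).
rewrite mulr_suml; apply: eq_bigr => i _.
rewrite /weighted /tail add1n -mulrA; congr (_ * _).
by rewrite [in LHS]exprSr invfM mulrC.
Qed.

Section Base.
Variable beta : R.
Hypothesis b1 : 1 < beta.

Let b0 : 0 < beta. Proof. by apply: lt_trans b1. Qed.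
Let bn0 : beta != 0. Proof. by rewrite gt_eqF. Qed.
Let bm1 : 0 < beta - 1. Proof. by rewrite subr_gt0. Qed.
Let expb0 n : 0 < beta ^+ n. Proof. exact: exprn_gt0. Qed.

Lemma max_valueE : max_value beta = (N.-1%:R + max_value beta) / beta.
Proof. by rewrite /max_value; field; rewrite bn0 gt_eqF. Qed.

Lemma max_value_ge0 : 0 <= max_value beta.
Proof. by rewrite divr_ge0// ltW. Qed.

Lemma digit_le d i : digit_sequence N d -> (d i)%:R <= N.-1%:R :> R.
Proof. by move=> dN; rewrite ler_nat; have := dN i; lia. Qed.

Lemma weighted_ge0 d i : 0 <= weighted beta d i.
Proof. by rewrite divr_ge0// ltW. Qed.

Lemma series_le_max_value d n : digit_sequence N d ->
  series (weighted beta d) n <= max_value beta.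
Proof.
elim: n d => [|n IH] d dN; first by rewrite /series /= big_geq// max_value_ge0.
rewrite seriesS// max_valueE ler_pM2r ?invr_gt0//.
by apply: lerD; [exact: digit_le | apply: IH; exact: digits_tail].
Qed.

Lemma nondecreasing_series_weighted d :
  {homo series (weighted beta d) : n m / (n <= m)%N >-> n <= m}.
Proof. by apply: nondecreasing_series => i _ _; exact: weighted_ge0. Qed.

Lemma cvg_value d : digit_sequence N d ->
  series (weighted beta d) @ \oo --> value beta d.
Proof.
move=> dN; apply: nondecreasing_is_cvgn; first exact: nondecreasing_series_weighted.
by exists (max_value beta) => _ [n _ <-]; exact: series_le_max_value.
Qed.

Lemma block_value_le_value d n : digit_sequence N d ->
  block_value beta (subword d 0 n) <= value beta d.
Proof.
move=> dN; rewrite block_value_subword; apply: nondecreasing_cvgn_le.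
  exact: nondecreasing_series_weighted.
by apply/cvg_ex; exists (value beta d); exact: cvg_value.
Qed.

Lemma value_ge0 d : digit_sequence N d -> 0 <= value beta d.
Proof.
move=> dN; apply: le_trans (block_value_le_value 0 dN).
by rewrite /block_value big_ord0.
Qed.

Lemma value_le d x : digit_sequence N d ->
  (forall n, block_value beta (subword d 0 n) <= x) -> value beta d <= x.
Proof.
move=> dN H; apply: limr_le.
  by apply/cvg_ex; exists (value beta d); exact: cvg_value.
by near=> n; rewrite -block_value_subword.
Unshelve. all: by end_near. Qed.

Lemma value_le_max d : digit_sequence N d -> value beta d <= max_value beta.
Proof.
by move=> dN; apply: value_le => // n; rewrite block_value_subword series_le_max_value.
Qed.

Lemma value_head d : digit_sequence N d ->
  value beta d = ((d 0%N)%:R + value beta (tail 1 d)) / beta.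
Proof.
move=> dN; apply: (@cvg_unique _ _ (series (weighted beta d) n.+1 @[n --> \oo])) => //.
  by have := cvg_value dN; rewrite -cvg_shiftS.
rewrite (_ : (fun n => series (weighted beta d) n.+1) =
  fun n => ((d 0%N)%:R + series (weighted beta (tail 1 d)) n) / beta); last first.
  by apply/funext => n; rewrite seriesS.
apply: cvgMl; apply: cvgD; first exact: cvg_cst.
by apply: cvg_value; exact: digits_tail.
Qed.

Lemma value_tail d n : digit_sequence N d ->
  value beta (tail n d) = ((d n)%:R + value beta (tail n.+1 d)) / beta.
Proof.
by move=> dN; rewrite value_head ?tail_tail ?addn1 /tail ?addn0//; apply: digits_tail.
Qed.

Lemma value_split d n : digit_sequence N d ->
  value beta d = block_value beta (subword d 0 n) + value beta (tail n d) / beta ^+ n.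
Proof.
move=> dN; elim: n => [|n IH]; first by rewrite /block_value big_ord0 add0r expr0 divr1.
rewrite IH block_value_subword block_value_subword /series /= big_nat_recr//= -addrA.
congr (_ + _); rewrite value_tail// /weighted exprSr.
by field; rewrite bn0 gt_eqF.
Qed.

Lemma value_max : value beta (fun=> N.-1) = max_value beta.
Proof.
have cN : digit_sequence N (fun=> N.-1) by move=> i; lia.
have vE : value beta (fun=> N.-1) =
    (N.-1%:R + value beta (fun=> N.-1)) / beta := value_head cN.
have {vE} : value beta (fun=> N.-1) * (beta - 1) = N.-1%:R.
  by rewrite mulrBr mulr1 {1}vE divfK// addrK.
by rewrite /max_value => <-; rewrite mulfK// gt_eqF.
Qed.

Lemma value_mirror d : digit_sequence N d ->
  value beta (mirror N d) = max_value beta - value beta d.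
Proof.
move=> dN; apply/eqP; rewrite eq_sym subr_eq eq_sym -value_max; apply/eqP.
have mN : digit_sequence N (mirror N d) by apply: digits_mirror; lia.
apply: (@cvg_unique _ _ (series (weighted beta (fun=> N.-1)) @ \oo)) => //; last first.
  by apply: cvg_value => i; lia.
have -> : series (weighted beta (fun=> N.-1)) =
    series (weighted beta (mirror N d)) \+ series (weighted beta d).
  apply/funext => n; rewrite /series /= -big_split/=; apply: eq_bigr => i _.
  by rewrite /weighted -mulrDl -natrD /mirror; congr (_%:R / _); have := dN i; lia.
by apply: cvgD; exact: cvg_value.
Qed.

Lemma expansionP x d :
  expansion N beta x d <-> digit_sequence N d /\ value beta d = x.
Proof.
split=> [[dN dx]|[dN <-]]; split => //; last exact: cvg_value.
by apply: (@cvg_unique _ _ (series (weighted beta d) @ \oo)) => //; exact: cvg_value.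
Qed.

Lemma max_value_gt1 : beta < N%:R -> 1 < max_value beta.
Proof.
move=> bN; rewrite /max_value ltr_pdivlMr ?subr_gt0// mul1r ltrBlDr natr1.
by rewrite prednK//; lia.
Qed.

(** * Unique expansions *)

Section Existence.
Hypothesis bN : beta <= N%:R.

Lemma max_value_ge1 : 1 <= max_value beta.
Proof.
rewrite /max_value ler_pdivlMr// mul1r lerBlDr natr1.
by rewrite prednK//; lia.
Qed.

(** One step of the greedy algorithm: beta <= N leaves no gap between the
    intervals of the numbers whose first digit can be c, for c < N. *)
Lemma next_digit y : 0 <= y <= max_value beta ->
  exists c, (c < N)%N /\ 0 <= y * beta - c%:R <= max_value beta.
Proof.
move=> /andP[y0 yC].
have yb0 : 0 <= y * beta by rewrite mulr_ge0// ltW.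
have /andP[f1 f2] := truncn_itv yb0; set c := Num.truncn (y * beta) in f1 f2.
have [cN|Nc] := ltnP c N.
  exists c; split => //; rewrite subr_ge0 f1 /=.
  apply: le_trans max_value_ge1; rewrite lerBlDl natr1; exact: ltW.
exists N.-1; split; first by lia.
apply/andP; split.
  by rewrite subr_ge0; apply: le_trans f1; rewrite ler_nat; lia.
rewrite lerBlDl; apply: le_trans (ler_wpM2r (ltW b0) yC) _.
by rewrite {1}max_valueE divfK.
Qed.

Lemma exists_value y : 0 <= y <= max_value beta ->
  exists e, digit_sequence N e /\ value beta e = y.
Proof.
move=> yC.
have /choice[f fP] : forall y : R, exists c, 0 <= y <= max_value beta ->
    (c < N)%N /\ 0 <= y * beta - c%:R <= max_value beta.
  move=> z; have [zC|nzC] := boolP (0 <= z <= max_value beta); last by exists 0%N.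
  by have [c cP] := next_digit zC; exists c.
pose g z := z * beta - (f z)%:R.
pose s n := iter n g y.
have sC n : 0 <= s n <= max_value beta.
  by elim: n => //= n IH; case: (fP _ IH).
pose e n := f (s n).
have eN : digit_sequence N e by move=> n; case: (fP _ (sC n)).
exists e; split => //.
have sE n : y = series (weighted beta e) n + s n / beta ^+ n.
  elim: n => [|n IH]; first by rewrite /series /= big_geq// add0r expr0 divr1.
  rewrite {1}IH /series /= big_nat_recr//= -addrA; congr (_ + _).
  rewrite -/(s n) /g /weighted /e exprSr.
  by field; rewrite bn0 gt_eqF.
apply/eqP; rewrite -subr_eq0 -normr_eq0; apply/eqP.
have small n : `|value beta e - y| <= max_value beta * (beta^-1) ^+ n.
  rewrite (sE n) (value_split n eN) block_value_subword.
  have -> : forall a b c : R, a + b - (a + c) = b - c by move=> *; ring.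
  rewrite -mulrBl exprVn normrM [X in _ * X]gtr0_norm ?invr_gt0//.
  rewrite ler_pM2r ?invr_gt0//.
  have /andP[s0 s1] := sC n.
  have := value_ge0 (digits_tail n eN); have := value_le_max (digits_tail n eN).
  by rewrite ler_norml; lra.
apply/eqP; rewrite eq_le normr_ge0 andbT.
have : max_value beta * beta^-1 ^+ n @[n --> \oo] --> (0 : R).
  apply: cvg_geometric; rewrite ger0_norm ?invr_ge0 ?ltW//.
  by rewrite invf_lt1.
move=> cv; rewrite -(cvg_lim _ cv)//; apply: limr_ge.
  by apply/cvg_ex; exists 0.
by near=> n; exact: small.
Unshelve. all: by end_near. Qed.

(** If the rest were worth 1 or more, the digit d n could be raised by one and
    the rest replaced with an expansion of its value minus 1. *)
Lemma univoque_value_lt1 d n : digit_sequence N d ->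
  univoque N beta (value beta d) -> (d n < N.-1)%N ->
  value beta (tail n.+1 d) < 1.
Proof.
move=> dN [_ [e [_ eU]]] dn; rewrite ltNge; apply/negP => v1.
have tN := digits_tail n.+1 dN.
have [|f [fN fv]] := @exists_value (value beta (tail n.+1 d) - 1).
  by rewrite subr_ge0 v1 /= lerBlDr; apply: le_trans (value_le_max tN) _; rewrite lerDl.
pose d' i := if (i < n)%N then d i else if i == n then (d n).+1 else f (i - n.+1)%N.
have d'N : digit_sequence N d'.
  by move=> i; rewrite /d'; case: ifP => // _; case: ifP => // _; lia.
have t'E : tail n.+1 d' = f.
  apply/funext => i; rewrite /tail /d' ifF; last by lia.
  by rewrite ifF ?addKn//; apply/eqP; lia.
have d'E : value beta d' = value beta d.
  rewrite (value_split n.+1 d'N) (value_split n.+1 dN) t'E fv.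
  rewrite !block_value_subword /series /= !big_nat_recr//=.
  have -> : \sum_(0 <= i < n) weighted beta d' i = \sum_(0 <= i < n) weighted beta d i.
    by apply: eq_big_nat => i /andP[_ i_n]; rewrite /weighted /d' i_n.
  rewrite /weighted /d' ltnn eqxx -natr1.
  by ring.
have Ed : e = d by apply: eU; apply/expansionP.
have Ed' : e = d' by apply: eU; apply/expansionP.
have : d' n = d n by rewrite -Ed' Ed.
by rewrite /d' ltnn eqxx; lia.
Qed.

Lemma univoque_mirror d : digit_sequence N d ->
  univoque N beta (value beta d) -> univoque N beta (value beta (mirror N d)).
Proof.
move=> dN [_ [e [_ eU]]].
have mN : digit_sequence N (mirror N d) by apply: digits_mirror; lia.
have Ed : e = d by apply: eU; apply/expansionP.
split; first by exists (mirror N d); apply/expansionP.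
exists (mirror N d); split; first by apply/expansionP.
move=> f /expansionP[fN fv]; rewrite -Ed (eU (mirror N f)) ?mirrorK//.
apply/expansionP; split; first by apply: digits_mirror; lia.
by rewrite value_mirror// fv value_mirror//; ring.
Qed.

(** Reading a digit N-1 turns a value v < 1 into v beta - (N-1) < beta - (N-1),
    which is at most 1; so the bound of the hypothesis propagates beyond the
    digits N-1. *)
Lemma value_lt1_tail d k n : digit_sequence N d ->
  (forall n, (d n < N.-1)%N -> value beta (tail n.+1 d) < 1) ->
  (d k < N.-1)%N -> (k < n)%N -> value beta (tail n d) < 1.
Proof.
move=> dN H dk; elim: n => // n IH; rewrite ltnS leq_eqVlt => /orP[/eqP <-|kn].
  exact: H.
have [dn|dn] := ltnP (d n) N.-1; first exact: H.
have := IH kn; rewrite value_tail// ltr_pdivrMr// mul1r => v1.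
have : (N%:R : R) = N.-1%:R + 1 by rewrite natr1 prednK//; lia.
have : (N.-1%:R : R) <= (d n)%:R by rewrite ler_nat.
by move: bN; lra.
Qed.

Definition value_bounded (e : nat -> nat) : Prop := digit_sequence N e /\
  forall n, value beta (tail n e) < 1 /\ value beta (tail n (mirror N e)) < 1.

(** After one digit below N-1 and one digit above 0 have been read, the bounds
    hold at all later positions. *)
Lemma univoque_tail x : univoque N beta x ->
  exists2 d, digit_sequence N d /\ value beta d = x &
  [\/ d = (fun=> 0%N), d = (fun=> N.-1) | exists k, value_bounded (tail k d)].
Proof.
move=> xU; have [[d /expansionP[dN dx]] _] := xU; exists d => //.
have [[k dk]|/forallNP Hk] := pselect (exists k, (d k < N.-1)%N); last first.
  by constructor 2; apply/funext => i; have := Hk i; have := dN i; lia.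
have [[l dl]|/forallNP Hl] := pselect (exists l, (0 < d l)%N); last first.
  by constructor 1; apply/funext => i; have := Hl i; lia.
constructor 3; exists (maxn k l).+1; split; first exact: digits_tail.
have mN : digit_sequence N (mirror N d) by apply: digits_mirror; lia.
rewrite -dx in xU.
move=> n; rewrite mirror_tail !tail_tail; split.
  apply: (@value_lt1_tail _ k) => //; last by lia.
  by move=> i; exact: univoque_value_lt1.
apply: (@value_lt1_tail _ l) => //; last by lia.
  by move=> i; apply: univoque_value_lt1 => //; exact: univoque_mirror.
by rewrite /mirror; have := dN l; lia.
Qed.

End Existence.

End Base.

Lemma block_value_le_base (beta gamma : R) d n : 0 < beta <= gamma ->
  block_value gamma (subword d 0 n) <= block_value beta (subword d 0 n).
Proof.
move=> /andP[b0 bg]; rewrite !block_value_subword.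
apply: ler_sum => i _; apply: ler_wpM2l => //.
rewrite lef_pV2 ?posrE ?exprn_gt0//; last exact: lt_le_trans bg.
by apply: lerXn2r => //; rewrite nnegrE; [exact: ltW | apply: ltW (lt_le_trans b0 bg)].
Qed.

Lemma value_le_base (beta gamma : R) d : digit_sequence N d -> 1 < beta <= gamma ->
  value gamma d <= value beta d.
Proof.
move=> dN /andP[b1 bg]; apply: value_le => //; first exact: lt_le_trans bg.
move=> n; apply: le_trans (block_value_le_value b1 n dN).
by apply: block_value_le_base; rewrite bg andbT; exact: lt_trans b1.
Qed.

(** * The quasi-greedy expansion of 1 *)

Section QuasiGreedy.
Variable beta : R.

Lemma block_value_rcons (s : seq nat) (c : nat) :
  block_value beta (rcons s c) = block_value beta s + c%:R / beta ^+ (size s).+1.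
Proof.
rewrite /block_value size_rcons big_ord_recr/= nth_rcons ltnn eqxx; congr (_ + _).
by apply: eq_bigr => i _; rewrite nth_rcons ltn_ord.
Qed.

Lemma size_quasi_greedy_prefix n : size (quasi_greedy_prefix N beta n) = n.
Proof. by elim: n => //= n IH; rewrite size_rcons IH. Qed.

Lemma subword_quasi_greedy n :
  subword (quasi_greedy N beta) 0 n = quasi_greedy_prefix N beta n.
Proof.
elim: n => // n IH; rewrite subwordS IH add0n /= /quasi_greedy /=.
by rewrite nth_rcons size_quasi_greedy_prefix ltnn eqxx.
Qed.

Lemma block_value_quasi_greedy n :
  block_value beta (subword (quasi_greedy N beta) 0 n) < 1.
Proof.
rewrite subword_quasi_greedy; elim: n => [|n IH]; first by rewrite /block_value big_ord0.
rewrite /=; set s := quasi_greedy_prefix N beta n.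
have N0 : (0 < N)%N by lia.
pose P := [pred c : 'I_N | block_value beta (rcons s c) < 1].
have : (0 < #|P|)%N.
  apply/card_gt0P; exists (Ordinal N0).
  by rewrite inE /= block_value_rcons mul0r addr0.
by case/(eq_bigmax_cond (fun c : 'I_N => c : nat)) => c; rewrite inE => Pc ->.
Qed.

(** As long as the two sequences agree, the next digit of e is one of the
    digits among which the quasi-greedy algorithm takes the largest. *)
Lemma block_le_quasi_greedy e n : digit_sequence N e ->
  (forall n, block_value beta (subword e 0 n) < 1) ->
  block_le (subword e 0 n) (subword (quasi_greedy N beta) 0 n).
Proof.
move=> eN H; elim: n => [//|n IH].
rewrite !subwordS -!cats1; apply: block_le_cat => //; first by rewrite !size_subword.
move=> eq_s; rewrite block_le_cons !add0n; set c := quasi_greedy N beta n.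
suff : (e n <= c)%N by case: ltngtP.
rewrite /c /quasi_greedy /= nth_rcons size_quasi_greedy_prefix ltnn eqxx.
apply: (@leq_bigmax_cond _ _ (fun c : 'I_N => c : nat) (Ordinal (eN n))).
by rewrite -subword_quasi_greedy -eq_s /= -[e n]/(e (0 + n)%N) -subwordS.
Qed.

End QuasiGreedy.

End Value.

(** * Sets of Hausdorff measure zero *)

Section HausdorffNull.
Local Open Scope ring_scope.
Local Open Scope classical_set_scope.
Variable R : realType.
Implicit Types (s : R) (E : set R).

(** The diameters of the covering sets are replaced with upper bounds r k and
    the series with its partial sums, so that covers can be handled with real
    numbers only. *)
Definition null s E : Prop := forall delta eps : R, 0 < delta -> 0 < eps ->
  exists (F : nat -> set R) (r : nat -> R),
  [/\ E `<=` \bigcup_k F k,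
      forall k, 0 <= r k <= delta,
      forall k x y, F k x -> F k y -> `|x - y| <= r k &
      forall n, \sum_(k < n) r k `^ s <= eps].

Lemma diam_ge0 E : E !=set0 -> (0 <= diam E)%E.
Proof.
case=> x Ex; apply: ereal_sup_ubound; exists (x, x) => //=.
by rewrite subrr normr0.
Qed.

Lemma diam_pow_ge0 s E : (0 <= diam_pow s E)%E.
Proof. by rewrite /diam_pow; case: ifP => // _; exact: poweR_ge0. Qed.

Lemma hausdorff_content_ge0 s delta E : (0 <= hausdorff_content s delta E)%E.
Proof.
apply: le_ereal_inf_tmp => _ [F _ <-].
by apply: nneseries_ge0 => k _ _; exact: diam_pow_ge0.
Qed.

Lemma hausdorff_measure_eq0 s E : hausdorff_measure s E = 0%E <->
  forall delta eps : R, 0 < delta -> 0 < eps ->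
    exists2 F, delta_cover delta E F & (\sum_(k <oo) diam_pow s (F k) < eps%:E)%E.
Proof.
split=> [H delta eps d0 e0|H].
  have /ereal_inf_lt[_ [F dF <-] lt_eps] : (hausdorff_content s delta E < eps%:E)%E.
    apply: (@le_lt_trans _ _ 0%E); last by rewrite lte_fin.
    by rewrite -H; apply: ereal_sup_ubound; exists delta.
  by exists F.
apply/eqP; rewrite eq_le; apply/andP; split.
  apply: ge_ereal_sup => _ [delta /= d0 <-].
  apply/lee_addgt0Pr => eps e0; rewrite add0e; have [F dF Fe] := H _ _ d0 e0.
  by apply: ge_ereal_inf; exists (\sum_(k <oo) diam_pow s (F k))%E; [exists F | exact: ltW].
apply: le_trans (hausdorff_content_ge0 s 1 E) _.
by apply: ereal_sup_ubound; exists 1 => //=.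
Qed.

Lemma hausdorff_measure_nullP s E : 0 < s ->
  hausdorff_measure s E = 0%E <-> null s E.
Proof.
move=> s0; split => [/hausdorff_measure_eq0 H delta eps d0 e0|H].
  have [F [EF Fd] Fe] := H _ _ d0 e0.
  pose r k := if F k == set0 then 0 else fine (diam (F k)).
  have rE k : F k != set0 -> (r k)%:E = diam (F k).
    move=> Fk; rewrite /r (negPf Fk) fineK// ge0_fin_numE.
      by apply: le_lt_trans (Fd k) _; rewrite ltry.
    by apply: diam_ge0; exact/set0P.
  exists F, r; split => //.
  - move=> k; have [Fk|Fk] := eqVneq (F k) set0.
      by rewrite /r Fk eqxx lexx ltW.
    rewrite -!lee_fin rE//; apply/andP; split; last exact: Fd.
    by apply: diam_ge0; exact/set0P.
  - move=> k x y Fx Fy; have Fk : F k != set0 by apply/set0P; exists x.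
    by rewrite -lee_fin rE//; apply: ereal_sup_ubound; exists (x, y).
  - move=> n; rewrite -lee_fin -sumEFin; apply: le_trans (ltW Fe).
    apply: le_trans (nneseries_lim_ge n _); last by move=> k _ _; exact: diam_pow_ge0.
    rewrite big_mkord; apply: lee_sum => k _.
    rewrite /diam_pow; case: ifPn => Fk; first by rewrite /r Fk powR0// gt_eqF.
    by rewrite -rE// poweR_EFin.
apply/hausdorff_measure_eq0 => delta eps d0 e0.
have e20 : 0 < eps / 2 by rewrite divr_gt0.
have [F [r [EF rd Fr rs]]] := H _ _ d0 e20.
have Fdiam k : (diam (F k) <= (r k)%:E)%E.
  by apply: ge_ereal_sup => _ [[x y] /= [Fx Fy] <-]; rewrite lee_fin Fr.
exists F.
  split=> // k; apply: le_trans (Fdiam k) _.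
  by rewrite lee_fin; case/andP: (rd k).
apply: (@le_lt_trans _ _ (eps / 2)%:E); last by rewrite lte_fin; lra.
apply: lime_le; first by apply: is_cvg_nneseries => k _ _; exact: diam_pow_ge0.
apply: nearW => n; rewrite big_mkord.
apply: (@le_trans _ _ (\sum_(k < n) (r k `^ s)%:E)%E); last first.
  by rewrite sumEFin lee_fin.
apply: lee_sum => k _; rewrite /diam_pow; case: ifPn => [_|/set0P Fk].
  by rewrite lee_fin powR_ge0.
rewrite -poweR_EFin; apply: gt0_ler_poweR; first exact: ltW.
- by rewrite in_itv /= leey andbT; exact: diam_ge0.
- by rewrite in_itv /= leey andbT lee_fin; case/andP: (rd k).
- exact: Fdiam.
Qed.

Lemma null_sub s A B : A `<=` B -> null s B -> null s A.
Proof.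
move=> AB H delta eps d0 e0; have [F [r [BF *]]] := H _ _ d0 e0.
by exists F, r; split => //; exact: subset_trans BF.
Qed.

Lemma null_set1 s x : 0 < s -> null s [set x].
Proof.
move=> s0 delta eps d0 e0; exists (fun=> [set x]), (fun=> 0); split.
- by move=> y ->; exists 0%N.
- by move=> _; rewrite lexx ltW.
- by move=> _ y z -> ->; rewrite subrr normr0.
- by move=> n; rewrite big1 ?ltW// => k _; rewrite powR0// gt_eqF.
Qed.

Lemma sum_half (x : R) n :
  \sum_(k < n) x / 2 ^+ k.+1 = x - x / 2 ^+ n.
Proof.
elim: n => [|n IH]; first by rewrite big_ord0 expr0 divr1 subrr.
rewrite big_ord_recr/= IH exprS; field.
by rewrite expf_neq0.
Qed.

(** Partial sums along the enumeration of the pairs are bounded by sums over a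
    square that contains the pairs met so far. *)
Lemma sum_unpickle (g : nat * nat -> R) n : (forall p, 0 <= g p) ->
  exists m, \sum_(k < n) oapp g 0 (pickle_inv k) <=
            \sum_(a < m) \sum_(b < m) g (a : nat, b : nat).
Proof.
move=> g0; pose l := pmap (@pickle_inv (nat * nat)%type) (iota 0 n).
exists (\max_(p <- l) maxn p.1 p.2).+1; set m := _.+1.
have -> : \sum_(k < n) oapp g 0 (pickle_inv k) = \sum_(p <- l) g p.
  rewrite -(big_mkord xpredT (fun k => oapp g 0 (pickle_inv k))) /index_iota subn0 /l.
  elim: (iota 0 n) => [|k i IH]; first by rewrite !big_nil.
  by rewrite big_cons IH /=; case: pickle_inv => [p|] /=; rewrite ?big_cons ?add0r.
have -> : \sum_(a < m) \sum_(b < m) g (a : nat, b : nat) =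
    \sum_(p <- [seq (a, b) | a <- iota 0 m, b <- iota 0 m]) g p.
  rewrite big_allpairs_dep -(big_mkord xpredT (fun a => \sum_(b < m) g (a, b : nat))).
  rewrite /index_iota subn0; apply: eq_bigr => a _.
  by rewrite -(big_mkord xpredT (fun b => g (a, b))) /index_iota subn0.
set L := [seq _ | a <- _, b <- _].
have lL p : p \in l -> p \in L.
  case: p => a b ab; have : (maxn a b <= \max_(p <- l) maxn p.1 p.2)%N.
    exact: (@leq_bigmax_seq _ _ xpredT (fun p => maxn p.1 p.2) (a, b)).
  rewrite geq_max => /andP[am bm].
  by apply: (allpairs_f pair); rewrite mem_iota add0n ltnS.
rewrite (perm_big [seq p <- L | p \in l]); last first.
  apply: uniq_perm.
  - by apply: (pmap_uniq pickle_invK); exact: iota_uniq.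
  - by apply: filter_uniq; apply: allpairs_uniq; rewrite ?iota_uniq// => -[? ?] [? ?].
  - by move=> p; rewrite mem_filter; have := lL p; case: (p \in l) => //= ->.
by rewrite big_filter [leRHS](bigID (mem l))/= lerDl sumr_ge0.
Qed.

Lemma null_bigcup s (E : nat -> set R) : 0 < s -> (forall i, null s (E i)) ->
  null s (\bigcup_i E i).
Proof.
move=> s0 H delta eps d0 e0.
have /choice[Fr FrP] : forall i, exists Fr : (nat -> set R) * (nat -> R),
   [/\ E i `<=` \bigcup_k Fr.1 k, forall k, 0 <= Fr.2 k <= delta,
       forall k x y, Fr.1 k x -> Fr.1 k y -> `|x - y| <= Fr.2 k &
       forall n, \sum_(k < n) Fr.2 k `^ s <= eps / 2 ^+ i.+1].
  move=> i; have e20 : 0 < eps / 2 ^+ i.+1 by rewrite divr_gt0// exprn_gt0.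
  by have [F [r ?]] := H i _ _ d0 e20; exists (F, r).
pose F k := oapp (fun p => (Fr p.1).1 p.2) set0 (pickle_inv k).
pose r k := oapp (fun p => (Fr p.1).2 p.2) 0 (pickle_inv k).
exists F, r; split.
- move=> x [i _ Ex]; have [EF _ _ _] := FrP i.
  have [k _ Fx] := EF _ Ex.
  by exists (pickle (i, k)) => //; rewrite /F pickleK_inv.
- move=> k; rewrite /r; case: pickle_inv => [[i j]|] /=; last by rewrite lexx ltW.
  by have [_ + _ _] := FrP i; apply.
- move=> k x y; rewrite /F /r; case: pickle_inv => [[i j]|] //=.
  by have [_ _ + _] := FrP i; apply.
move=> n.
have [m] := @sum_unpickle (fun p => (Fr p.1).2 p.2 `^ s) n (fun=> powR_ge0 _ _).
have -> : \sum_(k < n) oapp (fun p => (Fr p.1).2 p.2 `^ s) 0 (pickle_inv k) =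
    \sum_(k < n) r k `^ s.
  apply: eq_bigr => k _; rewrite /r; case: pickle_inv => //=.
  by rewrite powR0// gt_eqF.
move=> /le_trans; apply.
apply: (@le_trans _ _ (\sum_(i < m) eps / 2 ^+ i.+1)).
  by apply: ler_sum => i _; have [_ _ _ +] := FrP i; apply.
by rewrite sum_half lerBlDr lerDl divr_ge0// ?ltW// exprn_ge0.
Qed.

Lemma nullU s A B : 0 < s -> null s A -> null s B -> null s (A `|` B).
Proof.
move=> s0 HA HB; rewrite -bigcup2inE.
apply: (@null_sub _ _ (\bigcup_i bigcup2 A B i)).
  by move=> x [i _ Ex]; exists i.
apply: null_bigcup => //; case=> [|[|i]] //=.
by apply: null_sub (null_set1 0 s0).
Qed.

End HausdorffNull.

(** * Counting the words of a subshift *)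

Section Counting.
Local Open Scope ring_scope.
Local Open Scope classical_set_scope.
Variable R : realType.

Lemma subadditive_iter (u : nat -> R) m r k :
  (forall i j, u (i + j)%N <= u i + u j) ->
  u (k * m + r)%N <= k%:R * u m + u r.
Proof.
move=> uD; elim: k => [|k IH]; first by rewrite mul0n add0n mul0r add0r.
rewrite mulSn -addnA; apply: le_trans (uD _ _) _.
by rewrite -natr1 mulrDl mul1r; lra.
Qed.

(** Fekete's lemma: the quotients converge to their infimum. *)
Lemma subadditive_cvg (u : nat -> R) : (forall n, 0 <= u n) ->
  (forall m n, u (m + n)%N <= u m + u n) -> cvgn (fun n => u n / n%:R).
Proof.
move=> u0 uD; pose A := [set u n / n%:R | n in [set n | (0 < n)%N]].
have A0 : A !=set0 by exists (u 1%N / 1%:R); exists 1%N.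
have lA : has_lbound A.
  by exists 0 => _ [n _ <-]; rewrite divr_ge0.
have infA n : (0 < n)%N -> inf A <= u n / n%:R.
  by move=> n0; apply: ge_inf => //; exists n.
apply/cvg_ex; exists (inf A); apply/cvgrPdist_le => eps e0.
have e20 : 0 < eps / 2 by rewrite divr_gt0.
have [_ [m m0 <-] mA] := inf_adherent e20 (conj A0 lA).
pose C := \sum_(r < m) u r.
have uC r : (r < m)%N -> u r <= C.
  move=> rm; rewrite /C (bigD1 (Ordinal rm))//= lerDl.
  by apply: sumr_ge0.
have C0 : 0 <= C by apply: sumr_ge0.
near=> n.
have n0 : (0 < n)%N by near: n; exists 1%N.
have nR : 0 < n%:R :> R by rewrite ltr0n.
have mR : 0 < m%:R :> R by rewrite ltr0n.
have Cn : C / n%:R <= eps / 2.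
  rewrite ler_pdivrMr// mulrC -ler_pdivrMr//.
  near: n; exists (Num.truncn (C / (eps / 2))).+1 => // k /= kC.
  apply: ltW; apply: lt_le_trans (truncnS_gt _) _.
  by rewrite ler_nat.
have le1 : u n <= (n %/ m)%:R * u m + u (n %% m)%N.
  by rewrite {1}(divn_eq n m); exact: subadditive_iter.
have le2 : (n %/ m)%:R * u m <= n%:R * (u m / m%:R).
  rewrite mulrA [n%:R * _]mulrC -mulrA [u m * _]mulrC ler_wpM2r//.
  by rewrite ler_pdivlMr// -natrM ler_nat leq_divM.
have le3 : u n / n%:R <= u m / m%:R + C / n%:R.
  rewrite ler_pdivrMr// mulrDl divfK ?gt_eqF//.
  by have := uC _ (ltn_pmod n m0); lra.
rewrite distrC ger0_norm ?subr_ge0 ?infA//.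
by lra.
Unshelve. all: by end_near. Qed.

Section Language.
Variables (N : nat) (X : set (nat -> nat)).
Hypothesis digitsX : forall d, X d -> digit_sequence N d.
Hypothesis tailX : forall n d, X d -> X (tail n d).

Definition words (n : nat) : seq (seq nat) :=
  [seq map val (w : n.-tuple 'I_N) | w <- enum (language N X n)].

Lemma size_words n : size (words n) = #|language N X n|.
Proof. by rewrite size_map cardE. Qed.

Lemma words_uniq n : uniq (words n).
Proof.
rewrite map_inj_uniq ?enum_uniq// => v w /(inj_map val_inj).
exact: val_inj.
Qed.

Lemma wordsP n u : u \in words n <-> exists2 d, X d & u = subword d 0 n.
Proof.
split=> [/mapP[w]|[d Xd ->]].
  rewrite mem_enum inE => /asboolP[d Xd [k wE]] ->.
  exists (tail k d); first exact: tailX.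
  by rewrite subword_tail addn0.
have sz : size (mkseq (fun i => Ordinal (digitsX Xd i)) n) == n by rewrite size_mkseq.
apply/mapP; exists (Tuple sz).
  rewrite mem_enum inE; apply/asboolP; exists d => //; exists 0%N.
  by rewrite /= /mkseq -map_comp.
by rewrite /= /mkseq -map_comp.
Qed.

Lemma card_languageD m n :
  (#|language N X (m + n)| <= #|language N X m| * #|language N X n|)%N.
Proof.
rewrite -!size_words -(size_allpairs cat).
apply: (@uniq_leq_size _ _ [seq u ++ v | u <- words m, v <- words n]).
  exact: words_uniq.
move=> _ /wordsP[d Xd ->]; rewrite subwordD; apply: allpairs_f.
  by apply/wordsP; exists d.
by apply/wordsP; exists (tail m d); [exact: tailX | rewrite subword_tail addn0].
Qed.

Let log_card n : R := ln #|language N X n|%:R.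

Lemma log_card_ge0 n : 0 <= log_card n.
Proof.
rewrite /log_card; case: #|_| => [|k]; first by rewrite ln0.
by rewrite ln_ge0// ler1n.
Qed.

Lemma log_cardD m n : log_card (m + n) <= log_card m + log_card n.
Proof.
have := card_languageD m n; rewrite /log_card.
case: #|language N X (m + n)| => [|k].
  by rewrite ln0// addr_ge0//; exact: log_card_ge0.
case: #|language N X m| => [|i]; first by rewrite mul0n.
case: #|language N X n| => [|j]; first by rewrite muln0.
move=> kij; rewrite -lnM ?posrE ?ltr0n//.
by rewrite ler_ln ?posrE ?mulr_gt0 ?ltr0n// -natrM ler_nat.
Qed.

Lemma cvg_entropy :
  ln #|language N X n|%:R / n%:R @[n --> \oo] --> entropy R N X.
Proof. exact: (subadditive_cvg log_card_ge0 log_cardD). Qed.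

Lemma entropy_ge0 : 0 <= entropy R N X.
Proof.
apply: limr_ge; first by apply/cvg_ex; exists (entropy R N X); exact: cvg_entropy.
by apply: nearW => n; rewrite divr_ge0// log_card_ge0.
Qed.

Lemma entropy_le (x C : R) : 0 <= x -> 1 <= C ->
  (forall n, #|language N X n|%:R <= C * expR (n%:R * x)) -> entropy R N X <= x.
Proof.
move=> x0 C1 H; apply/ler_addgt0Pr => eps e0; apply: limr_le.
  by apply/cvg_ex; exists (entropy R N X); exact: cvg_entropy.
have C0 : 0 < C by lra.
near=> n.
have n0 : (0 < n)%N by near: n; exists 1%N.
have nR : 0 < n%:R :> R by rewrite ltr0n.
have Cn : ln C <= n%:R * eps.
  rewrite -ler_pdivrMr//.
  near: n; exists (Num.truncn (ln C / eps)).+1 => // k /= kC.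
  apply: ltW; apply: lt_le_trans (truncnS_gt _) _.
  by rewrite ler_nat.
rewrite ler_pdivrMr//.
have : ln #|language N X n|%:R <= ln C + n%:R * x.
  have := H n; case: #|_| => [_|k Hk].
    by rewrite ln0// addr_ge0 ?ln_ge0// mulr_ge0.
  rewrite -[X in _ + X]expRK -lnM ?posrE ?expR_gt0//.
  by rewrite ler_ln ?posrE ?ltr0n// mulr_gt0// expR_gt0.
by lra.
Unshelve. all: by end_near. Qed.

Lemma entropy_lt (x : R) : entropy R N X < x ->
  \forall n \near \oo, #|language N X n|%:R <= expR (n%:R * x).
Proof.
move=> hx; have /cvgrPdist_lt/(_ (x - entropy R N X)) := cvg_entropy.
rewrite subr_gt0 => /(_ hx) ev; near=> n.
have n0 : (0 < n)%N by near: n; exists 1%N.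
have nR : 0 < n%:R :> R by rewrite ltr0n.
have : `|entropy R N X - ln #|language N X n|%:R / n%:R| < x - entropy R N X.
  by near: n.
rewrite ltr_distlC => /andP[_]; rewrite addrC subrK ltr_pdivrMr// mulrC.
case: #|_| => [|k] lnk; first by rewrite ltW// expR_gt0.
by rewrite -ler_ln ?posrE ?ltr0n ?expR_gt0// expRK ltW.
Unshelve. all: by end_near. Qed.

(** Removing from a word of length n the word w k it begins with leaves a word
    of length n - |w k|, hence a recursive bound on the number of words. As the
    weights q ^ |w k| have total at most 1, a bound on the number of words of
    length n times q ^ n passes from small n to all n. *)
Lemma card_language_le (q : R) (K : nat) (w : nat -> seq nat) : 0 < q ->
  (forall k, (0 < size (w k))%N) ->
  (forall d, X d -> exists2 k, (k < K)%N & subword d 0 (size (w k)) = w k) ->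
  \sum_(k < K) q ^+ size (w k) <= 1 ->
  exists2 C : R, 1 <= C & forall n, #|language N X n|%:R * q ^+ n <= C.
Proof.
move=> q0 w0 cov sum1; pose a n : R := #|language N X n|%:R.
pose L := (\max_(k < K) size (w k))%N.
pose C := 1 + \sum_(n < L) a n * q ^+ n.
have aq0 n : 0 <= a n * q ^+ n by rewrite mulr_ge0// exprn_ge0// ltW.
have C1 : 1 <= C by rewrite lerDl sumr_ge0.
exists C => //; elim/ltn_ind => n IH.
have [nL|Ln] := ltnP n L.
  rewrite /C (bigD1 (Ordinal nL))//= addrCA lerDl.
  by rewrite addr_ge0// sumr_ge0.
have wn (k : 'I_K) : (size (w k) <= n)%N.
  apply: leq_trans Ln.
  exact: (leq_bigmax_cond (F := fun k : 'I_K => size (w k))).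
have card_le : (#|language N X n| <= \sum_(k < K) #|language N X (n - size (w k))|)%N.
  rewrite -size_words.
  pose l := flatten [seq [seq w k ++ v | v <- words (n - size (w k))] | k : 'I_K].
  apply: (@leq_trans (size l)).
    apply: uniq_leq_size; first exact: words_uniq.
    move=> _ /wordsP[d Xd ->]; have [k kK wk] := cov _ Xd.
    apply/flattenP; exists [seq w k ++ v | v <- words (n - size (w k))].
      by apply/mapP; exists (Ordinal kK); rewrite ?mem_enum.
    apply/mapP; exists (subword (tail (size (w k)) d) 0 (n - size (w k))).
      by apply/wordsP; exists (tail (size (w k)) d) => //; exact: tailX.
    by rewrite -{1}(subnKC (wn (Ordinal kK))) subwordD wk add0n subword_tail addn0.
  rewrite /l size_flatten /shape -map_comp sumnE big_map big_enum /=.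
  by apply: leq_sum => k _; rewrite size_map size_words.
apply: (@le_trans _ _ (\sum_(k < K) C * q ^+ size (w k))); last first.
  by rewrite -mulr_sumr -[leRHS]mulr1 ler_wpM2l// (le_trans ler01).
apply: (@le_trans _ _ ((\sum_(k < K) a (n - size (w k))%N) * q ^+ n)).
  apply: ler_wpM2r; first by rewrite exprn_ge0// ltW.
  rewrite (_ : \sum_(k < K) _ = (\sum_(k < K) #|language N X (n - size (w k))|)%:R).
    by rewrite /a ler_nat.
  by rewrite natr_sum.
rewrite mulr_suml; apply: ler_sum => k _.
rewrite -{2}(subnK (wn k)) exprD mulrA.
apply: ler_wpM2r; first by rewrite exprn_ge0// ltW.
by apply: IH; have := wn k; have := w0 k; lia.
Qed.

End Language.

(** * Compactness of subshifts *)

(** Koenig's lemma: among infinitely many sequences over finitely many digits,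
    some first digit occurs infinitely often, then some second one, and so
    on. *)
Lemma sequence_accumulation (N : nat) (z : nat -> nat -> nat) :
  (forall k, digit_sequence N (z k)) ->
  exists y, forall n m, exists2 k, (m <= k)%N & subword (z k) 0 n = subword y 0 n.
Proof.
move=> zN; pose P w := forall m, exists2 k, (m <= k)%N & subword (z k) 0 (size w) = w.
have /choice[f fP] : forall w, exists c, P w -> P (rcons w c).
  move=> w; have [Pw|nPw] := pselect (P w); last by exists 0%N.
  have [[c Pc]|/forallNP H] := pselect (exists c, P (rcons w c)).
    by exists c.
  exfalso.
  have /choice[g gP] : forall c, exists m, forall k, (m <= k)%N ->
      subword (z k) 0 (size (rcons w c)) <> rcons w c.
    move=> c; have /existsNP[m Hm] := H c; exists m => k mk wE.
    by apply: Hm; exists k.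
  have [k kg wk] := Pw (\max_(c < N) g c)%N.
  apply: (gP (z k (size w)) k).
    apply: leq_trans kg.
    exact: (leq_bigmax_cond (F := fun c : 'I_N => g c) (Ordinal (zN k (size w)))).
  by rewrite size_rcons subwordS wk.
pose W n := iter n (fun w => rcons w (f w)) [::].
have WP n : P (W n).
  by elim: n => [m|n IH]; [exists m | exact: fP].
pose y n := f (W n); exists y => n m.
have yW : subword y 0 n = W n by elim: n => // n IH; rewrite subwordS IH.
have [k mk wk] := WP n m; exists k => //.
by move: wk; rewrite yW -{1}yW size_subword.
Qed.

(** Otherwise sequences of X avoiding longer and longer initial parts of the
    family of cylinders would accumulate at a sequence of X, which lies in none
    of them. *)
Lemma finite_cylinder_cover (N : nat) (X : set (nat -> nat)) (w : nat -> seq nat) :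
  (forall d, X d -> digit_sequence N d) ->
  (forall y, (forall n, exists2 d, X d & subword d 0 n = subword y 0 n) -> X y) ->
  (forall d, X d -> exists k, subword d 0 (size (w k)) = w k) ->
  exists K, forall d, X d -> exists2 k, (k < K)%N & subword d 0 (size (w k)) = w k.
Proof.
move=> XN Xclosed cov; apply: contrapT => /forallNP H.
have /choice[z zP] : forall K, exists d, X d /\
    forall k, (k < K)%N -> subword d 0 (size (w k)) <> w k.
  move=> K; have /existsNP[d /not_implyP[Xd nd]] := H K.
  by exists d; split => // k kK wk; apply: nd; exists k.
have [y yP] := sequence_accumulation (fun k => XN _ (zP k).1).
have Xy : X y.
  by apply: Xclosed => n; have [k _ ky] := yP n 0%N; exists (z k) => //; case: (zP k).
have [k ky] := cov _ Xy.
have [j kj jy] := yP (size (w k)) k.+1.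
by apply: (zP j).2 kj _; rewrite jy.
Qed.

End Counting.

(** * Powers of the base *)

Section Powers.
Local Open Scope ring_scope.
Local Open Scope classical_set_scope.
Variable R : realType.

Lemma geometric_le_near (q eps : R) : 0 <= q < 1 -> 0 < eps ->
  exists n0, forall n, (n0 <= n)%N -> q ^+ n <= eps.
Proof.
move=> /andP[q0 q1] e0.
have : geometric 1 q @ \oo --> 0 by apply: cvg_geometric; rewrite ger0_norm.
move=> /cvgrPdist_le/(_ _ e0)[n0 _ H]; exists n0 => n /H.
by rewrite /= mul1r sub0r normrN; exact: le_trans (ler_norm _).
Qed.

Variable beta : R.
Hypothesis b1 : 1 < beta.

Let b0 : 0 < beta. Proof. exact: lt_trans b1. Qed.
Let expb0 n : 0 < beta ^+ n. Proof. exact: exprn_gt0. Qed.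

Lemma invr_lt1_itv : 0 <= beta^-1 < 1.
Proof. by rewrite invr_ge0 ltW//= invf_lt1. Qed.

Lemma powRN_lt1 (s : R) : 0 < s -> 0 < beta `^ (- s) < 1.
Proof.
move=> s0; rewrite powR_gt0//= powRN invf_lt1 ?powR_gt0// (_ : 1 = 1 `^ s); last by rewrite powR1.
by apply: gt0_ltr_powR => //; rewrite nnegrE ?ler01 ?ltW.
Qed.

Lemma powRN_exp (s : R) m : (beta `^ (- s)) ^+ m = (beta ^- m) `^ s.
Proof.
elim: m => [|m IH]; first by rewrite !expr0 invr1 powR1.
rewrite exprS IH exprS invfM powRM ?invr_ge0 ?ltW//; congr (_ * _).
by rewrite -(powR_inv1 (ltW b0)) -powRrM mulN1r.
Qed.

Lemma powRN_expR (s : R) n : (beta `^ (- s)) ^+ n = expR (- (n%:R * (s * ln beta))).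
Proof.
rewrite -[beta `^ (- s)]lnK ?posrE ?powR_gt0// ln_powR -expRM_natl.
by congr expR; ring.
Qed.

(** A set of diameter r lies in a cylinder of the length m given here once
    points outside a common cylinder of length m are at distance c / beta ^ m
    or more. The term tau is there for r = 0. *)
Lemma cylinder_length (c s r tau : R) : 0 < c -> 0 < s ->
  0 <= r < c / beta -> 0 < tau ->
  exists m, [/\ (0 < m)%N, r < c / beta ^+ m &
    (beta `^ (- s)) ^+ m <= (beta / c) `^ s * r `^ s + tau].
Proof.
move=> c0 s0 /andP[r0 rc] tau0.
have /andP[q0 q1] := powRN_lt1 s0.
have [->|rn0] := eqVneq r 0.
  have [|m Hm] := @geometric_le_near (beta `^ (- s)) tau _ tau0; first by rewrite ltW.
  exists m.+1; split => //; first by rewrite divr_gt0// exprn_gt0.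
  by rewrite powR0 ?gt_eqF// mulr0 add0r Hm.
have rp : 0 < r by rewrite lt_neqAle eq_sym rn0.
have exm : exists m, c / beta ^+ m <= r.
  have [||m Hm] := @geometric_le_near beta^-1 (r / c).
  - exact: invr_lt1_itv.
  - by rewrite divr_gt0.
  by exists m; rewrite -exprVn mulrC -ler_pdivlMr// Hm.
(* The length m.+1 is the last one with r < c / beta ^+ m.+1; the next one is
   comparable with r up to the factor beta / c. *)
case: (ex_minnP exm) => [[|[|m]]] mr min_m.
- move: mr; rewrite expr0 divr1 leNgt => /negP[].
  by apply: lt_le_trans rc _; rewrite ler_pdivrMr// ler_peMr// ltW.
- by move: mr; rewrite expr1 leNgt rc.
exists m.+1; split => //.
  by rewrite ltNge; apply/negP => /min_m; rewrite ltnn.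
rewrite powRN_exp -powRM ?divr_ge0 ?ltW//.
have : (beta ^- m.+1) `^ s <= (beta / c * r) `^ s; last by lra.
apply: ge0_ler_powR; rewrite ?nnegrE.
- exact: ltW.
- by rewrite invr_ge0 ltW.
- by apply: ltW; rewrite mulr_gt0// divr_gt0.
have -> : beta ^- m.+1 = beta / c * (c / beta ^+ m.+2).
  by rewrite [beta ^+ m.+2]exprS; field; rewrite !gt_eqF.
by rewrite ler_pM2l// divr_gt0.
Qed.

End Powers.

(** * Countable sets of sequences *)

Section Points.
Local Open Scope ring_scope.
Local Open Scope classical_set_scope.
Variables (R : realType) (N : nat) (beta s : R).
Hypothesis s0 : 0 < s.

Definition tail_values (X : set (nat -> nat)) : set R :=
  [set value beta d | d in [set d | digit_sequence N d /\ exists n, X (tail n d)]].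

Definition glue (w : seq nat) (e : nat -> nat) (i : nat) : nat :=
  if (i < size w)%N then nth 0%N w i else e (i - size w)%N.

(** Only countably many sequences have the tail e: they are given by the finite
    words put in front of it. *)
Lemma null_tail_values1 e : null s (tail_values [set e]).
Proof.
apply: (@null_sub _ _ _
  (\bigcup_i [set value beta (glue (odflt [::] (unpickle i)) e)])).
  move=> _ [d [_ [n de]] <-]; exists (pickle (subword d 0 n)) => //.
  rewrite pickleK [odflt _ _]/=; congr value; apply/funext => i.
  rewrite /glue size_subword; case: ltnP => ni; first by rewrite nth_subword.
  by rewrite -de /tail subnKC.
by apply: null_bigcup => // i; exact: null_set1.
Qed.

End Points.

(** * Values of the sequences of the shift of finite type *)

Section BlockShift.
Local Open Scope ring_scope.
Local Open Scope classical_set_scope.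
Variables (R : realType) (N : nat) (t : seq nat).
Hypotheses (N1 : (1 < N)%N) (t0 : (0 < size t)%N) (tN : is_block N t).

Local Notation Z := (Zshift N t).

Lemma digits_periodic : digit_sequence N (Defs.periodic t).
Proof. by move=> i; apply: (allP tN); apply: mem_nth; rewrite ltn_mod. Qed.

Lemma subword_periodic : subword (Defs.periodic t) 0 (size t) = t.
Proof.
apply: (@eq_from_nth _ 0%N); rewrite size_subword// => i ip.
by rewrite nth_subword// /Defs.periodic modn_small.
Qed.

Lemma tail_periodic : tail (size t) (Defs.periodic t) = Defs.periodic t.
Proof. by apply/funext => i; rewrite /tail /Defs.periodic modnDl. Qed.

Lemma Zshift_digits d : Z d -> digit_sequence N d.
Proof. by case. Qed.

Lemma Zshift_tail n d : Z d -> Z (tail n d).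
Proof.
by move=> [dN H]; split; [exact: digits_tail | move=> m; rewrite subword_tail].
Qed.

Lemma Zshift_mirror d : Z d -> Z (mirror N d).
Proof.
move=> [dN H]; split; first by apply: digits_mirror; lia.
have rN : is_block N (reflection N t) by apply: is_block_reflection; lia.
move=> n; have [H1 H2] := H n; rewrite -reflection_subword; split.
  by rewrite block_le_reflection ?size_subword//; exact: is_block_subword.
rewrite -[X in block_le _ X](reflectionK tN) block_le_reflection//.
  by rewrite size_subword size_reflection.
exact: is_block_subword.
Qed.

Lemma Zshift_closed y :
  (forall n, exists2 d, Z d & subword d 0 n = subword y 0 n) -> Z y.
Proof.
move=> H; split=> [i|n].
  have [d [dN _]] := H i.+1.
  by move=> /subwordP/(_ (ltnSn i)); rewrite !add0n => <-.
have [d [_ dZ]] := H (n + size t)%N; rewrite !subwordD !add0n => /eqP.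
by rewrite eqseq_cat ?size_subword// => /andP[_ /eqP <-].
Qed.

Section Base.
Variable beta : R.
Hypotheses (b1 : 1 < beta) (bN : beta < N%:R).
Hypothesis value_t : block_value beta t <= 1 - (beta ^+ size t)^-1.

Let b0 : 0 < beta. Proof. exact: lt_trans b1. Qed.
Let expb0 n : 0 < beta ^+ n. Proof. exact: exprn_gt0. Qed.
Local Notation M := (max_value N beta).

(** The first deviation from t, at the digit k, costs at least one unit there,
    for which the tail starting at k.+1 has to make up. *)
Lemma Zshift_value_step d : Z d -> subword d 0 (size t) = t \/
  exists k, value beta d <=
    block_value beta t + (value beta (tail k.+1 d) - 1) / beta ^+ k.+1.
Proof.
move=> Zd; have [dN /(_ 0%N)[_ dt]] := Zd.
have [|dE|[k [kt takeE dk]]] := block_le_diff _ dt; first by rewrite size_subword.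
  by left.
right; exists k; rewrite size_subword in kt.
rewrite nth_subword// add0n in dk.
have dE : subword d 0 k = subword (Defs.periodic t) 0 k.
  apply: eq_subword => i ik.
  have := congr1 (nth 0%N ^~ i) takeE; rewrite /= !nth_take// nth_subword ?(ltn_trans ik)//.
  by move=> ->; rewrite /Defs.periodic add0n modn_small// (ltn_trans ik).
have tE : block_value beta (subword (Defs.periodic t) 0 k.+1) <= block_value beta t.
  rewrite -[in leRHS]subword_periodic !block_value_subword.
  exact: (nondecreasing_series_weighted b1).
rewrite (value_split N1 b1 k.+1 dN) mulrBl.
suff : block_value beta (subword d 0 k.+1) <=
  block_value beta (subword (Defs.periodic t) 0 k.+1) - 1 / beta ^+ k.+1 by lra.
have split_last e : block_value beta (subword e 0 k.+1) =
    block_value beta (subword e 0 k) + (e k)%:R / beta ^+ k.+1.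
  by rewrite !block_value_subword /series /= big_nat_recr.
rewrite !split_last dE -addrA lerD2l -mulrBl ler_pM2r ?invr_gt0//.
by rewrite lerBrDr natr1 ler_nat /Defs.periodic modn_small.
Qed.

(** Each use of the previous lemma reduces an excess over 1 at least by the
    factor beta. *)
Lemma Zshift_value_le1 d : Z d -> value beta d <= 1.
Proof.
have vt1 : block_value beta t <= 1.
  by apply: le_trans value_t _; rewrite lerBlDr lerDl invr_ge0 ltW.
have M1 := max_value_gt1 N1 b1 bN.
have main j : forall d, Z d -> value beta d <= 1 + M * beta^-1 ^+ j.
  elim: j => [e eZ|j IH e eZ].
    by rewrite expr0 mulr1; have := value_le_max N1 b1 (Zshift_digits eZ); lra.
  have low k : M * beta^-1 ^+ j / beta ^+ k.+1 <= M * beta^-1 ^+ j.+1.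
    rewrite [beta^-1 ^+ j.+1]exprSr mulrA; apply: ler_wpM2l.
      by rewrite mulr_ge0 ?exprn_ge0 ?invr_ge0 ?(ltW b0)//; lra.
    rewrite lef_pV2 ?posrE// exprS ler_peMr ?exprn_ege1//; exact: ltW.
  have [te|[k vk]] := Zshift_value_step eZ.
    rewrite (value_split N1 b1 (size t) (Zshift_digits eZ)) te.
    have := low (size t).-1; rewrite prednK//.
    have : value beta (tail (size t) e) / beta ^+ size t <=
       (1 + M * beta^-1 ^+ j) / beta ^+ size t.
      by rewrite ler_pM2r ?invr_gt0//; apply: IH; exact: Zshift_tail.
    rewrite mulrDl mul1r; move: value_t; lra.
  have := low k.
  have : (value beta (tail k.+1 e) - 1) / beta ^+ k.+1 <=
     (M * beta^-1 ^+ j) / beta ^+ k.+1.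
    rewrite ler_pM2r ?invr_gt0// lerBlDl; apply: IH; exact: Zshift_tail.
  lra.
move=> dZ.
have : 1 + M * beta^-1 ^+ j @[j --> \oo] --> 1 + (0 : R).
  apply: cvgD; first exact: cvg_cst.
  apply: cvg_geometric; rewrite ger0_norm ?invr_ge0 ?ltW//.
  by rewrite invf_lt1.
rewrite addr0 => cv; rewrite -(cvg_lim _ cv)//; apply: limr_ge.
  by apply/cvg_ex; exists 1.
by apply: nearW => j; exact: main.
Qed.

(** A deviation from t gives a value below 1, since t itself is worth less
    than 1; so the successive blocks of length |t| are all equal to t. *)
Lemma Zshift_value_eq1 d : Z d -> value beta d = 1 -> d = Defs.periodic t.
Proof.
move=> dZ v1.
have head e : Z e -> value beta e = 1 ->
    subword e 0 (size t) = t /\ value beta (tail (size t) e) = 1.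
  move=> eZ ev; have eN := Zshift_digits eZ.
  have tv := Zshift_value_le1 (Zshift_tail _ eZ).
  have [te|[k vk]] := Zshift_value_step eZ; last first.
    have : (value beta (tail k.+1 e) - 1) / beta ^+ k.+1 <= 0.
      by rewrite pmulr_lle0 ?invr_gt0// subr_le0.
    have : 0 < (beta ^+ size t)^-1 by rewrite invr_gt0.
    by move: value_t; lra.
  split=> //; apply/eqP; rewrite eq_le tv /=.
  have := value_split N1 b1 (size t) eN; rewrite te ev => vE.
  have : (beta ^+ size t)^-1 <= value beta (tail (size t) e) / beta ^+ size t.
    by move: value_t; lra.
  by rewrite -[leLHS]mul1r ler_pM2r ?invr_gt0.
have main j : forall e, Z e -> value beta e = 1 ->
    forall i, (i < j * size t)%N -> e i = Defs.periodic t i.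
  elim: j => // j IH e eZ ev i; have [te tv] := head _ eZ ev.
  rewrite mulSn; have [ip _|pi ij] := ltnP i (size t).
    by rewrite /Defs.periodic modn_small// -[in RHS]te nth_subword.
  rewrite -(subnKC pi) -[LHS]/(tail (size t) e (i - size t)%N).
  rewrite (IH _ (Zshift_tail _ eZ) tv); last by lia.
  by rewrite -[in LHS]tail_periodic.
by apply/funext => i; apply: (main i.+1) => //; nia.
Qed.

Lemma value_split_digit d n : digit_sequence N d -> value beta d =
  block_value beta (subword d 0 n) +
  ((d n)%:R + value beta (tail n.+1 d)) / beta ^+ n.+1.
Proof.
move=> dN; rewrite (value_split N1 b1 n dN) (value_tail N1 b1 _ dN).
by congr (_ + _); rewrite exprS invfM mulrA.
Qed.

Lemma Zshift_value_ge d : Z d -> M - 1 <= value beta d.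
Proof.
move=> dZ; have := Zshift_value_le1 (Zshift_mirror dZ).
by rewrite value_mirror//; [lra | exact: Zshift_digits].
Qed.

(** The larger digit at index n is worth at least 1 more, and the rests take
    back at most 1 - (M - 1), as their values lie between M - 1 and 1. The gap
    M - 1 is positive because beta < N. *)
Lemma Zshift_separation d e n : Z d -> Z e ->
  subword d 0 n = subword e 0 n -> d n <> e n ->
  (M - 1) / beta ^+ n.+1 <= `|value beta d - value beta e|.
Proof.
have main d' e' : Z d' -> Z e' -> subword d' 0 n = subword e' 0 n ->
    (e' n < d' n)%N -> (M - 1) / beta ^+ n.+1 <= value beta d' - value beta e'.
  move=> dZ eZ de en.
  rewrite (value_split_digit n (Zshift_digits dZ)).
  rewrite (value_split_digit n (Zshift_digits eZ)) de.
  rewrite opprD addrACA subrr add0r -mulrBl ler_pM2r ?invr_gt0//.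
  have := Zshift_value_ge (Zshift_tail n.+1 dZ).
  have := Zshift_value_le1 (Zshift_tail n.+1 eZ).
  have : (e' n)%:R + 1 <= (d' n)%:R :> R by rewrite natr1 ler_nat.
  by lra.
move=> dZ eZ de /eqP; rewrite neq_ltn => /orP[den|edn].
  by rewrite distrC; apply: le_trans (ler_norm _); exact: main.
by apply: le_trans (ler_norm _); exact: main.
Qed.

(** At the first digit where another expansion differs, the rest of d would
    have to be worth 1 or, after reflection, 1. *)
Lemma Zshift_univoque d : Z d -> (forall n, tail n d <> Defs.periodic t) ->
  (forall n, tail n (mirror N d) <> Defs.periodic t) -> univoque N beta (value beta d).
Proof.
move=> dZ nt nmt; have dN := Zshift_digits dZ.
have dE : expansion N beta (value beta d) d by apply/expansionP.
split; first by exists d.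
exists d; split => // e /expansionP[//|//|eN ev].
apply: contrapT => de.
have exn : exists n, d n != e n.
  apply: contrapT => /forallNP H; apply: de; apply/funext => n.
  by apply/eqP/negPn/negP; exact: H.
have nn := ex_minnP exn; case: nn => n dn min_n.
have den : subword d 0 n = subword e 0 n.
  apply: eq_subword => i i_n; rewrite add0n; apply/eqP/negPn/negP => /min_n.
  by rewrite leqNgt i_n.
have := ev; rewrite (value_split_digit n dN) (value_split_digit n eN) den.
move=> /addrI /(mulIf _) vE; have {}vE := vE (invr_neq0 (lt0r_neq0 (expb0 n.+1))).
have te0 := value_ge0 N1 b1 (digits_tail n.+1 eN).
have teM := value_le_max N1 b1 (digits_tail n.+1 eN).
move: dn; rewrite neq_ltn => /orP[dn|dn].
  apply: (nt n.+1); apply: Zshift_value_eq1; first exact: Zshift_tail.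
  apply/eqP; rewrite eq_le Zshift_value_le1//=; last exact: Zshift_tail.
  have : (d n)%:R + 1 <= (e n)%:R :> R by rewrite natr1 ler_nat.
  by lra.
apply: (nmt n.+1); apply: Zshift_value_eq1.
  by apply: Zshift_tail; exact: Zshift_mirror.
have vm := value_mirror N1 b1 (digits_tail n.+1 dN).
rewrite -mirror_tail; apply/eqP; rewrite eq_le Zshift_value_le1//=; last first.
  by apply: Zshift_mirror; exact: Zshift_tail.
rewrite vm.
have : (e n)%:R + 1 <= (d n)%:R :> R by rewrite natr1 ler_nat.
by lra.
Qed.

(** The values of the shift that are not univoque come from the countably many
    sequences ending in t t t ... or in its reflection. *)
Lemma null_Zshift s : 0 < s -> null s (univoque N beta) ->
  null s [set value beta d | d in Z].
Proof.
move=> s0 nU; apply: (@null_sub _ _ _ (univoque N beta `|`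
   (tail_values N beta [set Defs.periodic t] `|`
    tail_values N beta [set mirror N (Defs.periodic t)]))).
  move=> _ [d dZ <-]; have dN := Zshift_digits dZ.
  have [[n tn]|/forallNP nt] := pselect (exists n, tail n d = Defs.periodic t).
    by right; left; exists d => //; split => //; exists n.
  have [[n tn]|/forallNP nmt] := pselect (exists n, tail n (mirror N d) = Defs.periodic t).
    right; right; exists d => //; split => //; exists n => /=.
    by rewrite -tn -mirror_tail mirrorK//; exact: digits_tail.
  by left; exact: Zshift_univoque.
by apply: nullU => //; apply: nullU => //; exact: null_tail_values1.
Qed.

End Base.
End BlockShift.

(** * The lower bound *)

Section LowerBound.
Local Open Scope ring_scope.
Local Open Scope classical_set_scope.
Variables (R : realType) (N : nat) (t : seq nat) (beta : R).
Hypotheses (N1 : (1 < N)%N) (t0 : (0 < size t)%N) (tN : is_block N t).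
Hypotheses (b1 : 1 < beta) (bN : beta < N%:R).
Hypothesis value_t : block_value beta t <= 1 - (beta ^+ size t)^-1.

Local Notation Z := (Zshift N t).
Local Notation M := (max_value N beta).

Let b0 : 0 < beta. Proof. exact: lt_trans b1. Qed.

Lemma univoque0 : univoque N beta 0.
Proof.
have zN : digit_sequence N (fun=> 0%N) by move=> i; lia.
have v0 : value beta (fun=> 0%N) = 0.
  apply/eqP; rewrite eq_le (value_ge0 N1 b1 zN) andbT; apply: (value_le N1 b1 zN) => n.
  rewrite block_value_subword /series /= big1// => i _.
  by rewrite /weighted mul0r.
have zE : expansion N beta 0 (fun=> 0%N) by apply/expansionP.
split; first by exists (fun=> 0%N).
exists (fun=> 0%N); split => // e /expansionP[//|//|eN ev].
apply/funext => n; apply/eqP; rewrite eq_sym -leqn0 -(ler_nat R).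
have := block_value_le_value N1 b1 n.+1 eN; rewrite ev block_value_subword.
rewrite /series /= big_nat_recr//= => le0.
have : weighted beta e n <= 0.
  apply: le_trans le0; rewrite lerDr; apply: sumr_ge0 => i _.
  exact: weighted_ge0.
by rewrite /weighted pmulr_lle0// invr_gt0 exprn_gt0.
Qed.

(** Covers of the values by small sets become, by separation, covers of the
    shift by long cylinders, and by compactness finitely many of them suffice
    to bound the number of words of the shift. *)
Lemma null_entropy_le s : 0 < s -> null s (univoque N beta) ->
  entropy R N Z <= s * ln beta.
Proof.
move=> s0 nU.
have nZ := null_Zshift N1 t0 tN b1 bN value_t s0 nU.
set c := M - 1.
have c0 : 0 < c by rewrite subr_gt0 (max_value_gt1 N1 b1 bN).
set q := beta `^ (- s); have q0 : 0 < q by rewrite powR_gt0.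
set B := (beta / c) `^ s; have B0 : 0 < B by rewrite powR_gt0// divr_gt0.
have [||F [r [ZF rd Fr rs]]] := nZ (c / beta / 2) (1 / (2 * B)).
- by rewrite !divr_gt0.
- by rewrite divr_gt0// mulr_gt0.
have /choice[m mP] : forall k, exists m, [/\ (0 < m)%N, r k < c / beta ^+ m &
    q ^+ m <= B * r k `^ s + (1 / 2) / 2 ^+ k.+1].
  move=> k; apply: cylinder_length => //.
  have /andP[-> /= rk] := rd k; apply: le_lt_trans rk _.
  by rewrite gtr_pMr ?divr_gt0// invf_lt1// ltr1n.
have zN : digit_sequence N (fun=> 0%N) by move=> i; lia.
have /choice[z zP] : forall k, exists z, forall d, Z d -> F k (value beta d) ->
    Z z /\ F k (value beta z).
  move=> k; have [[z zP]|/forallNP H] := pselect (exists z, Z z /\ F k (value beta z)).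
    by exists z.
  by exists (fun=> 0%N) => d dZ dF; case: (H d).
pose w k := subword (z k) 0 (m k).
have sw k : size (w k) = m k by rewrite size_subword.
have cov d : Z d -> exists k, subword d 0 (size (w k)) = w k.
  move=> dZ; have [k _ dF] := ZF _ (ex_intro2 _ _ d dZ erefl).
  exists k; rewrite sw /w; have [zZ zF] := zP _ _ dZ dF.
  have [m0 rm _] := mP k.
  apply: contrapT => ne.
  have exn : exists n, (n < m k)%N && (d n != z k n).
    apply: contrapT => /forallNP H; apply: ne; apply: eq_subword => i im.
    by rewrite add0n; apply/eqP/negPn/negP => di; apply: (H i); rewrite im.
  case: (ex_minnP exn) => n /andP[nm dn] min_n.
  have dz : subword d 0 n = subword (z k) 0 n.
    apply: eq_subword => i i_n; rewrite add0n; apply/eqP/negPn/negP => di.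
    have := min_n i; rewrite di (ltn_trans i_n nm) => /(_ isT).
    by rewrite leqNgt i_n.
  have /eqP dn' := dn.
  have := Zshift_separation N1 t0 tN b1 bN value_t dZ zZ dz dn'.
  rewrite leNgt => /negP[]; apply: le_lt_trans (Fr k _ _ dF zF) _.
  apply: lt_le_trans rm _; rewrite ler_pM2l// lef_pV2 ?posrE ?exprn_gt0//.
  by rewrite ler_eXn2l.
have ZN d : Z d -> digit_sequence N d by exact: Zshift_digits.
have Zt n d : Z d -> Z (tail n d) by exact: Zshift_tail.
have [K finK] := finite_cylinder_cover ZN (@Zshift_closed _ _) cov.
have sumK : \sum_(k < K) q ^+ size (w k) <= 1.
  apply: (@le_trans _ _ (\sum_(k < K) (B * r k `^ s + (1 / 2) / 2 ^+ k.+1))).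
    by apply: ler_sum => k _; rewrite sw; case: (mP k).
  rewrite big_split/= -mulr_sumr sum_half.
  have : B * (\sum_(k < K) r k `^ s) <= B * (1 / (2 * B)) by rewrite ler_pM2l.
  have -> : B * (1 / (2 * B)) = 1 / 2 by field; rewrite gt_eqF.
  have : 0 <= 1 / 2 / 2 ^+ K :> R by rewrite !divr_ge0// exprn_ge0.
  lra.
have w0 k : (0 < size (w k))%N by rewrite sw; case: (mP k).
have [C C1 HC] := card_language_le ZN Zt q0 w0 finK sumK.
apply: (entropy_le ZN Zt _ C1).
  by rewrite mulr_ge0 ?ln_ge0 ?ltW.
move=> n; have := HC n; rewrite (powRN_expR b1) expRN.
by rewrite ler_pdivrMr// expR_gt0.
Qed.

Lemma hausdorff_null_entropy_le s : 0 <= s ->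
  hausdorff_measure s (univoque N beta) = 0%E -> entropy R N Z <= s * ln beta.
Proof.
rewrite le_eqVlt => /orP[/eqP <- H|s0 /(hausdorff_measure_nullP _ s0)]; last first.
  exact: null_entropy_le.
(* The measure of exponent 0 of a nonempty set is at least 1. *)
have [F [UF _] F1] := (hausdorff_measure_eq0 _ _).1 H 1 1 ltr01 ltr01.
have [k _ Fk] := UF _ univoque0.
have F0 i : (0 <= diam_pow 0 (F i))%E by exact: diam_pow_ge0.
have := nneseries_lim_ge k.+1 (fun i _ _ => F0 i) : (_ <= \sum_(i <oo | xpredT i) _)%E.
rewrite big_nat_recr//= => le1.
have : (1 <= diam_pow 0 (F k))%E.
  by rewrite /diam_pow ifF ?poweRe0//; apply/negbTE/set0P; exists 0.
move=> le2; exfalso; move: F1; rewrite ltNge => /negP; apply.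
apply: le_trans le1; apply: le_trans le2 _.
by rewrite leeDr// sume_ge0.
Qed.

End LowerBound.

(** * The upper bound *)

Section UpperBound.
Local Open Scope ring_scope.
Local Open Scope classical_set_scope.
Variables (R : realType) (N : nat).
Hypothesis N1 : (1 < N)%N.

Section Thin.
Variables (beta s : R).
Hypotheses (b1 : 1 < beta) (s0 : 0 < s).

Let b0 : 0 < beta. Proof. exact: lt_trans b1. Qed.
Local Notation q := (beta `^ (- s)).
Local Notation M := (max_value N beta).

(** The weights are only asked to be small along a sequence of lengths n, as in
    the lower box-counting dimension; multiples of a block length will do. *)
Definition thin (X : set (nat -> nat)) : Prop :=
  forall (eps : R) (n0 : nat), 0 < eps ->
  exists n, exists2 l : seq (seq nat), (n0 <= n)%N &
    (forall d, X d -> subword d 0 n \in l) /\ (size l)%:R * q ^+ n <= eps.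

Lemma sum_if_le (a : R) (K n : nat) : 0 <= a ->
  \sum_(k < n) (if (k < K)%N then a else 0) <= K%:R * a.
Proof.
move=> a0; apply: (@le_trans _ _ ((minn n K)%:R * a)); last first.
  by rewrite ler_wpM2r// ler_nat geq_minr.
elim: n => [|n IH]; first by rewrite big_ord0 min0n mul0r.
rewrite big_ord_recr/=; case: ltnP => nK.
  have -> : minn n.+1 K = (minn n K).+1 by lia.
  by rewrite -natr1 mulrDl mul1r lerD2r.
have -> : minn n.+1 K = minn n K by lia.
by rewrite addr0.
Qed.

(** Prefixing the words of a thin set with all words of a given length i costs
    a constant factor, and there are countably many i. *)
Lemma null_thin X : thin X -> null s (tail_values N beta X).
Proof.
move=> thinX; have /andP[q0 q1] := powRN_lt1 b1 s0.
have M0 : 0 < M by rewrite divr_gt0 ?subr_gt0// ltr0n; lia.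
apply: (@null_sub _ _ _ (\bigcup_i
    [set value beta d | d in [set d | digit_sequence N d /\ X (tail i d)]])).
  by move=> _ [d [dN [i di]] <-]; exists i => //; exists d.
apply: null_bigcup => // i delta eps d0 e0.
pose D := [set d | digit_sequence N d].
have DN d : D d -> digit_sequence N d by [].
have Dt n d : D d -> D (tail n d) by exact: digits_tail.
pose wl := words N D i.
have Ms0 : 0 < M `^ s by rewrite powR_gt0.
have wM0 : 0 < (size wl)%:R * M `^ s + 1 by rewrite ltr_wpDl// mulr_ge0// ltW.
have [||n0 Hn0] := @geometric_le_near _ beta^-1 (delta / M).
- exact: invr_lt1_itv.
- by rewrite divr_gt0.
have [|n [l nn0 [Xl le]]] := thinX (eps / ((size wl)%:R * M `^ s + 1)) n0.
  by rewrite divr_gt0.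
pose L := [seq u ++ v | u <- wl, v <- l].
have sL : size L = (size wl * size l)%N by rewrite size_allpairs.
pose rho := M * beta^-1 ^+ (i + n).
have rho0 : 0 <= rho by rewrite mulr_ge0 ?exprn_ge0 ?invr_ge0 ?ltW.
exists (fun k => if (k < size L)%N then [set value beta d | d in
     [set d | digit_sequence N d /\ subword d 0 (i + n) = nth [::] L k]] else set0),
  (fun k => if (k < size L)%N then rho else 0).
split.
- move=> _ [d [dN Xd] <-].
  have dL : subword d 0 (i + n) \in L.
    rewrite subwordD add0n; apply: allpairs_f; first by apply/wordsP => //; exists d.
    by have := Xl _ Xd; rewrite subword_tail addn0.
  exists (index (subword d 0 (i + n)) L) => //=.
  by rewrite index_mem dL; exists d => //; split => //; rewrite nth_index.
- move=> k; case: ifP => _; last by rewrite lexx ltW.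
  rewrite rho0 /= /rho mulrC -ler_pdivlMr//; apply: Hn0.
  exact: leq_trans nn0 (leq_addl _ _).
- move=> k x y; case: ifP => // _ [d [dN dk] <-] [e [eN ek] <-].
  rewrite (value_split N1 b1 (i + n) dN) (value_split N1 b1 (i + n) eN) dk ek.
  have -> : forall a b c : R, a + b - (a + c) = b - c by move=> *; ring.
  rewrite -mulrBl /rho exprVn normrM [X in _ * X]gtr0_norm ?invr_gt0 ?exprn_gt0//.
  rewrite ler_pM2r ?invr_gt0 ?exprn_gt0//.
  have := value_ge0 N1 b1 (digits_tail (i + n) dN).
  have := value_le_max N1 b1 (digits_tail (i + n) dN).
  have := value_ge0 N1 b1 (digits_tail (i + n) eN).
  have := value_le_max N1 b1 (digits_tail (i + n) eN).
  by rewrite ler_norml; lra.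
move=> m.
rewrite (eq_bigr (fun k : 'I_m => if (k < size L)%N then rho `^ s else 0)); last first.
  by move=> k _; case: ifP => // _; rewrite powR0// gt_eqF.
apply: le_trans (sum_if_le _ _ (powR_ge0 _ _)) _.
have -> : rho `^ s = M `^ s * (q ^+ i * q ^+ n).
  rewrite /rho powRM ?exprn_ge0 ?invr_ge0 ?(ltW b0) ?(ltW M0)//; congr (_ * _).
  by rewrite -exprD exprVn -(powRN_exp b1).
rewrite sL natrM.
have qi1 : q ^+ i <= 1 by rewrite exprn_ile1// ltW.
have -> : (size wl)%:R * (size l)%:R * (M `^ s * (q ^+ i * q ^+ n)) =
  q ^+ i * ((size wl)%:R * M `^ s * ((size l)%:R * q ^+ n)) by ring.
have wMl0 : 0 <= (size wl)%:R * M `^ s * ((size l)%:R * q ^+ n).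
  by rewrite !mulr_ge0 ?exprn_ge0 ?(ltW Ms0) ?(ltW q0).
apply: le_trans (ler_piMl wMl0 qi1) _.
apply: (@le_trans _ _ ((size wl)%:R * M `^ s * (eps / ((size wl)%:R * M `^ s + 1)))).
  by rewrite ler_wpM2l// mulr_ge0// ltW.
by rewrite mulrA ler_pdivrMr// mulrC ler_pM2l// lerDl.
Qed.

Lemma thin_entropy (X : set (nat -> nat)) :
  (forall d, X d -> digit_sequence N d) ->
  (forall n d, X d -> X (tail n d)) ->
  entropy R N X < s * ln beta -> thin X.
Proof.
move=> XN Xt hX eps n0 e0; set h := entropy R N X in hX.
have [hx xs] := midf_lt hX; set x := (h + s * ln beta) / 2 in hx xs.
have [n1 _ Hn1] := entropy_lt XN Xt hx.
have [|n2 Hn2] := @geometric_le_near _ (expR (x - s * ln beta)) eps _ e0.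
  by rewrite expR_ge0 expR_lt1 subr_lt0.
exists (maxn n0 (maxn n1 n2)); set n := maxn _ _.
exists (words N X n); first exact: leq_maxl.
split=> [d Xd|]; first by apply/wordsP => //; exists d.
apply: le_trans (Hn2 n _); last by rewrite /n; lia.
rewrite size_words (powRN_expR b1).
have := Hn1 n; rewrite /= => /(_ ltac:(rewrite /n; lia)) card_le.
apply: le_trans (ler_wpM2r (expR_ge0 _) card_le) _.
by rewrite -expRD -expRM_natl mulrBr.
Qed.

End Thin.
Section Univoque.
Variables (t : seq nat) (betaU beta s : R).
Hypotheses (t0 : (0 < size t)%N) (tN : is_block N t) (tl : (last 0%N t < N.-1)%N).
Hypothesis qgU : quasi_greedy N betaU = thue_morse N t.
Hypotheses (b1 : 1 < beta) (bU : beta <= betaU) (bN : beta <= N%:R) (s0 : 0 < s).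

(** Enlarging the base only decreases the partial sums, so they stay below 1 in
    the base betaU, whose quasi-greedy expansion of 1 is theta. *)
Lemma value_bounded_lex e : value_bounded N beta e -> lex_bounded N t e.
Proof.
move=> [eN H]; split => // n m; have [v1 v2] := H n.
have bU1 : 1 < betaU by exact: lt_le_trans bU.
have mN : digit_sequence N (mirror N e) by apply: digits_mirror; lia.
have main f : digit_sequence N f -> value beta f < 1 ->
    block_le (subword f 0 m) (subword (thue_morse N t) 0 m).
  move=> fN fv; rewrite -qgU; apply: block_le_quasi_greedy => // k.
  apply: le_lt_trans fv; apply: le_trans (block_value_le_value N1 b1 k fN).
  by apply: block_value_le_base; rewrite bU (lt_trans ltr01 b1).
split; first by have := main _ (digits_tail n eN) v1; rewrite subword_tail addn0.
by have := main _ (digits_tail n mN) v2; rewrite subword_tail addn0.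
Qed.

Lemma thin_level m : 4 * (beta `^ (- s)) ^+ size (thue_morse_block N t m) < 1 ->
  thin beta s (level N t m).
Proof.
set L := size _; set q := beta `^ (- s) => q4 eps n0 e0.
have L0 : (0 < L)%N by exact: thue_morse_block_gt0.
have /andP[q0 _] : 0 < q < 1 by exact: powRN_lt1.
have [|k0 Hk0] := @geometric_le_near _ (4 * q ^+ L) eps _ e0.
  by rewrite q4 andbT mulr_ge0// exprn_ge0// ltW.
exists (maxn n0 k0 * L)%N; exists (level_words N t m (maxn n0 k0)).
  by apply: leq_trans (leq_maxl n0 k0) _; rewrite leq_pmulr.
split=> [d|]; first exact: level_subword.
rewrite size_level_words// natrX mulnC exprM -exprMn.
by apply: Hk0; exact: leq_maxr.
Qed.

(** Up to countably many tails, the sequences of level 0 have tails of any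
    level m, and those have at most 4 ^ k initial words of length k 2^m p. *)
Lemma null_level : null s (tail_values N beta (level N t 0)).
Proof.
have /andP[q0 q1] := powRN_lt1 b1 s0; set q := beta `^ (- s) in q0 q1.
have [||m Hm] := @geometric_le_near _ q (1 / 8).
- by rewrite ltW.
- by [].
have : null s (tail_values N beta (level N t m)).
  apply: null_thin => //; apply: thin_level.
  have : q ^+ size (thue_morse_block N t m) <= 1 / 8.
    apply: Hm; rewrite size_thue_morse_block//.
    by have := ltn_expl m (isT : (1 < 2)%N); nia.
  by rewrite -/q; lra.
elim: m {Hm} => // m IH Hm; apply: IH.
have sub : tail_values N beta (level N t m) `<=` tail_values N beta (level N t m.+1) `|`
   (tail_values N beta [set alternation N (thue_morse_block N t m)] `|`
    tail_values N beta [set mirror N (alternation N (thue_morse_block N t m))]).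
  move=> _ [d [dN [n dn]] <-].
  case: (level_decomposition N1 t0 tN tl dn) => [[k dk]|dk|dk].
  - left; exists d => //; split => //; exists (n + k)%N.
    by rewrite -tail_tail.
  - by right; left; exists d => //; split => //; exists n.
  - by right; right; exists d => //; split => //; exists n.
apply: (null_sub sub).
by apply: nullU => //; apply: nullU => //; exact: null_tail_values1.
Qed.

Lemma null_univoque : entropy R N (Zshift N t) < s * ln beta ->
  null s (univoque N beta).
Proof.
move=> hs.
have nZ : null s (tail_values N beta (Zshift N t)).
  apply: null_thin => //; apply: thin_entropy => //.
    exact: Zshift_digits.
  by move=> n d; exact: Zshift_tail.
apply: (@null_sub _ _ _
  ((tail_values N beta [set (fun=> 0%N)] `|` tail_values N beta [set (fun=> N.-1)]) `|`
   (tail_values N beta (Zshift N t) `|` tail_values N beta (level N t 0)))).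
  move=> x xU; have [d [dN <-]] := univoque_tail N1 b1 bN xU.
  case=> [dE|dE|[k dk]].
  - by left; left; exists d => //; split => //; exists 0%N.
  - by left; right; exists d => //; split => //; exists 0%N.
  right; case: (lex_bounded_Zshift N1 t0 tN tl (value_bounded_lex dk)) => [dZ|[j dj]].
    by left; exists d => //; split => //; exists k.
  right; exists d => //; split => //; exists (k + j)%N.
  by rewrite -tail_tail.
by apply: nullU => //; apply: nullU => //; [exact: null_tail_values1 |
  exact: null_tail_values1 | exact: null_level].
Qed.

End Univoque.
End UpperBound.

(** * Bases of an admissible interval *)

Section BaseBounds.
Local Open Scope ring_scope.
Variables (R : realType) (N : nat) (t : seq nat).
Hypotheses (N1 : (1 < N)%N) (t0 : (0 < size t)%N) (tN : is_block N t)
  (tl : (last 0%N t < N.-1)%N).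

(** In base N all partial sums of (N-1)(N-1)... stay below 1, so that this
    sequence is the quasi-greedy expansion of 1. *)
Lemma thue_morse_base_lt (betaU : R) : betaU <= N%:R ->
  quasi_greedy N betaU = thue_morse N t -> betaU < N%:R.
Proof.
rewrite le_eqVlt => /orP[/eqP bE qg|//]; exfalso.
have [i iN] := thue_morse_not_max N1 t0 tN tl.
have cN : digit_sequence N (fun=> N.-1) by move=> k; lia.
have N0 : (N%:R : R) != 0 by rewrite pnatr_eq0; lia.
have c1 n : block_value betaU (subword (fun=> N.-1) 0 n) < 1.
  have -> : block_value betaU (subword (fun=> N.-1) 0 n) = 1 - betaU ^- n.
    rewrite block_value_subword /series /=.
    elim: n => [|n IH]; first by rewrite big_geq// expr0 invr1 subrr.
    rewrite big_nat_recr//= IH /weighted bE exprS.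
    have -> : (N.-1%:R : R) = N%:R - 1 by rewrite -{2}(prednK (ltnW N1)) -natr1 addrK.
    by field; rewrite N0 expf_neq0.
  by rewrite ltrBlDr ltrDl invr_gt0 bE exprn_gt0// ltr0n ltnW.
have := block_le_quasi_greedy i.+1 cN c1; rewrite qg.
case/block_le_diff => [|/subwordP/(_ (ltnSn i))|[k []]]; rewrite ?size_subword//.
  by rewrite !add0n => cE; move: iN; rewrite cE eqxx.
move=> ki _; rewrite !nth_subword// add0n.
by have := digits_thue_morse N1 t0 tN tl k; lia.
Qed.

(** The sequence t t t ... is worth at most 1 in the base betaL, hence in beta,
    and its value is a geometric series with the block t. *)
Lemma block_value_periodic (betaL beta : R) : 1 < betaL -> betaL <= beta ->
  quasi_greedy N betaL = Defs.periodic t ->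
  block_value beta t <= 1 - (beta ^+ size t)^-1.
Proof.
move=> bL1 bL qg; have b1 : 1 < beta by exact: lt_le_trans bL.
have pN : digit_sequence N (Defs.periodic t) by exact: digits_periodic.
have v1 : value beta (Defs.periodic t) <= 1.
  apply: (@le_trans _ _ (value betaL (Defs.periodic t))).
    by apply: (value_le_base N1 pN); rewrite bL1.
  apply: (value_le N1 bL1 pN) => n; rewrite -qg ltW//.
  exact: block_value_quasi_greedy.
have := value_split N1 b1 (size t) pN.
rewrite tail_periodic subword_periodic// => vE.
have e0 : 0 < beta ^+ size t by rewrite exprn_gt0// (lt_trans ltr01).
have -> : block_value beta t =
    value beta (Defs.periodic t) * (1 - (beta ^+ size t)^-1).
  by rewrite mulrBr mulr1 {1}vE addrK.
apply: ler_piMl => //; rewrite subr_ge0 invf_le1//.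
by rewrite exprn_ege1// ltW.
Qed.

End BaseBounds.

(** * The dimension formula *)

Local Open Scope ring_scope.

Theorem theorem2p6 (R : realType) (N : nat) (hN : (2 <= N)%N) (t : seq nat)
    (betaL betaU : R) (hadm : admissible_interval N t betaL betaU)
    (beta : R) (hbeta : betaL <= beta <= betaU) :
  hausdorff_dim (univoque N beta) = (entropy R N (Zshift N t) / ln beta)%:E.
Proof.
have [[t0 tN tl _] /andP[bL1 _] /andP[_ bUN] qgL qgU] := hadm.
have /andP[bL bU] := hbeta.
have b1 : 1 < beta by exact: lt_le_trans bL.
have bN : beta < N%:R by apply: le_lt_trans bU _; exact: (thue_morse_base_lt hN t0 tN tl).
have ln0 : 0 < ln beta by rewrite ln_gt0.
have vt := block_value_periodic hN t0 tN bL1 bL qgL.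
have ZN d : Zshift N t d -> digit_sequence N d by exact: Zshift_digits.
have Zt n d : Zshift N t d -> Zshift N t (tail n d) by exact: Zshift_tail.
apply/eqP; rewrite eq_le; apply/andP; split.
  apply/lee_addgt0Pr => eps e0; apply: ge_ereal_inf.
  exists (entropy R N (Zshift N t) / ln beta + eps)%:E => //.
  have s0 : 0 < entropy R N (Zshift N t) / ln beta + eps.
    by apply: ltr_wpDl => //; apply: divr_ge0; [exact: (entropy_ge0 R ZN Zt) | exact: ltW].
  exists (entropy R N (Zshift N t) / ln beta + eps) => //; split; first exact: ltW.
  apply/hausdorff_measure_nullP => //.
  apply: (null_univoque hN t0 tN tl qgU) => //; first exact: ltW.
  by rewrite mulrDl divfK ?gt_eqF// ltrDl mulr_gt0.
apply: le_ereal_inf_tmp => _ [s [s0 sU] <-].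
rewrite lee_fin ler_pdivrMr//.
exact: (hausdorff_null_entropy_le hN t0 tN b1 bN vt).
Qed.
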